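(* Let $p$ be a prime and $d\ge 1$ an integer. There does not exist any $C_p$-equivariant continuous map $$EC_p^{((p-1)(d+1))}\to S(\bar\rho^{\oplus(d+1)}).$$
   Context: $EC_p$ is a contractible free $C_p$-CW complex and $EC_p^{(n)}$ denotes its $n$-skeleton. $\bar\rho$ is the reduced real regular representation of $C_p$ (the regular representation modulo the trivial summand), of dimension $p-1$, and $S(W)$ is the unit sphere of an orthogonal representation $W$. *)

(* Defs.v *)
From HB Require Import structures.
From mathcomp Require Import all_boot all_order all_algebra all_fingroup all_solvable.
From mathcomp Require Import mxrepresentation.
From mathcomp Require Import all_classical all_reals all_analysis.

Set Implicit Arguments.
Unset Strict Implicit.
Unset Printing Implicit Defensive.

Import Order.TTheory GRing.Theory Num.Theory.
Import numFieldNormedType.Exports.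

Local Open Scope classical_set_scope.
Local Open Scope ring_scope.

(* Groups act on the right, as in MathComp's [action] and [mx_representation]
   (row vectors).  A left G-space is the same thing as a right G-space, via
   g |-> g^-1. *)

Section Cells.
Variables (R : realType) (n : nat).

(* Euclidean, not sup-norm, balls.  For n = 0 the disk and the open ball are
   the one-point space 'rV_0 and the sphere is empty. *)
Definition disk : set 'rV[R]_n := [set y | \sum_i y 0 i ^+ 2 <= 1].
Definition disk_interior : set 'rV[R]_n := [set y | \sum_i y 0 i ^+ 2 < 1].
Definition disk_boundary : set 'rV[R]_n := [set y | \sum_i y 0 i ^+ 2 = 1].

End Cells.

Arguments disk : clear implicits.
Arguments disk_interior : clear implicits.
Arguments disk_boundary : clear implicits.

Definition skeleton_below (X : Type) (skel : nat -> set X) (n : nat) : set X :=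
  if n is m.+1 then skel m else set0.

(* A G-CW complex, for a finite discrete group G: a G-space X with a filtration
   by G-subspaces X_0 <= X_1 <= ... whose union is X, such that X has the
   colimit topology and, with X_(-1) empty, for every n there is a pushout

       coprod_i (H_i\G x S^(n-1)) ----> X_(n-1)
                  |                        |
                  v                        v
       coprod_i (H_i\G x D^n)     ---->   X_n

   of G-spaces.  Such a G-map H_i\G x D^n -> X is (H_i g, y) |-> chi_i(y) g for
   a unique map chi_i : D^n -> X with values in the H_i-fixed points; the record
   contains the maps chi_i.  That the square is a pushout of topological spaces
   is spelled out as: the boundary goes to X_(n-1); H_i\G x (open cells) is
   mapped bijectively onto the complement of X_(n-1) in X_n; and X_n has the
   final topology. *)
Record GCW (R : realType) (gT : finGroupType) (X : topologicalType)
    (to : {action gT &-> X}) := MkGCW {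
  skel : nat -> set X;
  cell : nat -> Type;
  isotropy : forall n, cell n -> {group gT};
  chi : forall n, cell n -> 'rV[R]_n -> X;

  act_continuous : forall g : gT, continuous (fun x => to x g);

  skel_subset : forall n, skel n `<=` skel n.+1;
  skel_act : forall n x (g : gT), skel n x -> skel n (to x g);
  skel_cover : \bigcup_n skel n = [set: X];
  skel_colimit : forall A : set X,
    (forall n, closed (A : set (subspace (skel n)))) -> closed A;

  chi_continuous : forall n (i : cell n), {within disk R n, continuous (chi i)};
  chi_isotropy : forall n (i : cell n) y h,
    disk R n y -> h \in isotropy i -> to (chi i y) h = chi i y;
  chi_disk : forall n (i : cell n) y, disk R n y -> skel n (chi i y);
  chi_boundary : forall n (i : cell n) y,
    disk_boundary R n y -> skeleton_below skel n (chi i y);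
  chi_interior : forall n (i : cell n) y,
    disk_interior R n y -> ~ skeleton_below skel n (chi i y);
  chi_surjective : forall n x,
    skel n x -> ~ skeleton_below skel n x ->
    exists (i : cell n) (y : 'rV[R]_n) (g : gT),
      disk_interior R n y /\ x = to (chi i y) g;
  chi_injective : forall n (i j : cell n) y z (g h : gT),
    disk_interior R n y -> disk_interior R n z ->
    to (chi i y) g = to (chi j z) h ->
    [/\ i = j, y = z & (isotropy i :* g = isotropy i :* h)%g];
  chi_final : forall n (A : set X),
    closed (A : set (subspace (skeleton_below skel n))) ->
    (forall (i : cell n) (g : gT),
       closed ([set y | A (to (chi i y) g)] : set (subspace (disk R n)))) ->
    closed (A : set (subspace (skel n)))
}.

Definition free_action (gT : finGroupType) (X : Type)
    (to : {action gT &-> X}) : Prop :=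
  forall x (g : gT), to x g = x -> g = 1%g.

Definition contractible (R : realType) (X : topologicalType) : Prop :=
  exists (x0 : X) (H : X * R -> X),
    [/\ {within [set: X] `*` `[0, 1], continuous H},
        forall x, H (x, 0) = x
      & forall x, H (x, 1) = x0].

Section ReducedRegular.
Variables (R : realType) (gT : finGroupType).
Local Notation nG := #|[set: gT]%G|.

(* The orthogonal complement of the trivial summand, which is spanned by
   const_mx 1, in the regular representation with its standard inner product;
   it is the quotient of the regular representation by that summand. *)
Definition reduced_regular : set 'rV[R]_nG := [set v | \sum_j v 0 j = 0].

(* A vector of the k-fold direct sum is a k-row matrix, one row per summand. *)
Definition reduced_regular_sphere (k : nat) : set 'M[R]_(k, nG) :=
  [set M | (forall i, reduced_regular (row i M)) /\
           \sum_i \sum_j M i j ^+ 2 = 1].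

Definition regular_act (k : nat) (M : 'M[R]_(k, nG)) (g : gT) : 'M[R]_(k, nG) :=
  M *m regular_repr R [set: gT]%G g.

End ReducedRegular.

Arguments reduced_regular_sphere : clear implicits.

(* Maps A -> B between invariant subspaces; the values of f outside A are
   irrelevant. *)
Definition equivariant_map (gT : finGroupType) (X Y : topologicalType)
    (toX : X -> gT -> X) (toY : Y -> gT -> Y) (A : set X) (B : set Y)
    (f : X -> Y) : Prop :=
  [/\ {within A, continuous f},
      forall x, A x -> B (f x)
    & forall x g, A x -> f (toX x g) = toY (f x) g].

(* Main.v *)
(* Let N = (p-1)(d+1) = dim W, where W is the sum of d+1 copies of the reduced
   regular representation, and let J be the join of N+1 copies of C_p, an
   N-dimensional free C_p-complex.

   A contraction of EC gives, cone by cone, an equivariant map from J to EC.  By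
   compactness its image lies in a finite skeleton, and it can be pushed down to
   the N-skeleton: in an open cell of dimension n > N replace the map near the
   centre by a Lipschitz approximation, which misses a point because J meets only
   O(q^N) boxes of side 1/q, and project radially from that point.  Everything is
   done on orbits of cells, hence equivariantly.  So it is enough to exclude an
   equivariant map F from J to S(W).

   Label x in J by a row i and a proper nonempty subset A of C_p such that the
   entries of F(x) in row i indexed by A exceed the others by a fixed amount.  This
   gives a level (i, |A|), one of N, and an element of Z/p, the mean of A, on which
   C_p acts by translation.  Points that are close and have the same level have the
   same label.  With T the generator of C_p, Diff = T - 1 and Norm the sum of the
   powers of T, there are alternating cochains alpha_k on the labels with
   nu_k alpha_k = cobd alpha_(k-1), where alpha_0 = 1 and nu_k is alternately
   Diff and Norm; dually J carries chains c_k with boundary c_(k+1) = nu_k c_k,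
   each the cone of the previous one.  Pulled back to a fine subdivision of J,
   pairing cobd alpha_N with c_(N+1) gives 1 by induction, but it also gives 0, as
   an alternating cochain vanishes on N+1 labels with only N levels. *)
Require Import Defs.
From mathcomp Require Import all_boot all_order all_algebra all_fingroup all_solvable.
From mathcomp Require Import mxrepresentation ring lra zify.
From mathcomp Require Import all_classical all_reals all_analysis.
Import numFieldNormedType.Exports.

Set Implicit Arguments.
Unset Strict Implicit.
Unset Printing Implicit Defensive.

Import Order.TTheory GRing.Theory Num.Theory.

Local Open Scope ring_scope.

(** * Cochains on tuples and subdivision *)

Section Cochains.
Variables (V : eqType) (F : comNzRingType).
Implicit Types (w : seq V -> F) (s r : seq V).

Definition slice v w : seq V -> F := fun r => w (v :: r).

(* The alternating sum of the values of [w] on the tuples with one entry deleted,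
   in the augmented complex: the empty tuple has dimension -1. *)
Fixpoint cobd w s : F :=
  if s is v :: s' then w s' - cobd (slice v w) s' else 0.

Lemma cobd_ext w1 w2 s :
  (forall r, subseq r s -> (size r).+1 = size s -> w1 r = w2 r) ->
  cobd w1 s = cobd w2 s.
Proof.
elim: s w1 w2 => [//|v s IH] w1 w2 E /=.
rewrite (E s) ?subseq_cons //; congr (_ - _).
by apply: IH => r rs szr; apply: E => /=; rewrite ?eqxx ?szr.
Qed.

Lemma cobdB w1 w2 s : cobd (fun r => w1 r - w2 r) s = cobd w1 s - cobd w2 s.
Proof.
elim: s w1 w2 => [|v s IH] w1 w2 /=; first by rewrite subr0.
rewrite (IH (slice v w1) (slice v w2)); ring.
Qed.

Lemma cobdN w s : cobd (fun r => - w r) s = - cobd w s.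
Proof.
by elim: s w => [|v s IH] w /=; rewrite ?oppr0 // (IH (slice v w)) opprB opprK addrC.
Qed.

Lemma cobd0 s : cobd (fun=> 0) s = 0.
Proof. by elim: s => [//|v s IH] /=; rewrite /slice IH subr0. Qed.

Lemma cobd_sum I (x : seq I) (W : I -> seq V -> F) s :
  cobd (fun r => \sum_(i <- x) W i r) s = \sum_(i <- x) cobd (W i) s.
Proof.
elim: s W => [|v s IH] W /=; first by rewrite big1.
by rewrite (IH (fun i => slice v (W i))) -sumrB.
Qed.

(** The recursion reads [slice v (cobd w) + cobd (slice v w) = w]: slicing is a contracting
    homotopy, and induction on the tuple does the rest. *)
Lemma cobdK w s : cobd (cobd w) s = 0.
Proof.
elim: s w => [//|v s IH] w /=.
have -> : slice v (cobd w) = fun r => w r - cobd (slice v w) r by [].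
by rewrite cobdB IH subr0 subrr.
Qed.


Section Subdivision.
Variable b : seq V -> V.

(* The transpose of barycentric subdivision on n-tuples, [b] being the barycenter;
   [flag] lists the tuples that occur in the subdivision. *)
Fixpoint sd n w s : F :=
  if n is n'.+1 then cobd (sd n' (slice (b s) w)) s else w s.

Fixpoint flag n s s' : Prop :=
  if n is n'.+1 then exists r t, [/\ subseq r s, (size r).+1 = size s,
     s' = b s :: t & flag n' r t] else s' = s.

Lemma flag_size n s s' : size s = n -> flag n s s' -> size s' = n.
Proof.
elim: n s s' => [|n IH] s s' sz /=; first by move->.
by case=> r [t [_ szr -> fl]] /=; rewrite (IH r t) //; move: szr; rewrite sz => -[].
Qed.

Lemma flag_closed (P : V -> Prop) n s s' :
  (forall r, r != [::] -> (forall x, x \in r -> P x) -> P (b r)) ->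
  size s = n -> (forall x, x \in s -> P x) -> flag n s s' -> forall x, x \in s' -> P x.
Proof.
move=> Pb; elim: n s s' => [|n IH] s s' sz Ps /=; first by move->.
case=> r [t [rs szr -> fl]] x; rewrite in_cons => /predU1P [->|].
  by apply: Pb Ps; case: (s) sz.
apply: (IH r) => //; first by move: szr; rewrite sz => -[].
by move=> y /(mem_subseq rs); exact: Ps.
Qed.

Lemma sd_ext n w1 w2 s : size s = n -> (forall s', flag n s s' -> w1 s' = w2 s') ->
  sd n w1 s = sd n w2 s.
Proof.
elim: n w1 w2 s => [|n IH] w1 w2 s sz E /=; first exact: E.
apply: cobd_ext => r rs szr; apply: IH; first by move: szr; rewrite sz => -[].
by move=> t ft; apply: E => /=; exists r, t.
Qed.

Lemma sdB n w1 w2 s : sd n (fun r => w1 r - w2 r) s = sd n w1 s - sd n w2 s.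
Proof.
elim: n w1 w2 s => [//|n IH] w1 w2 s /=.
by rewrite -cobdB; apply: cobd_ext => r _ _; apply: IH.
Qed.

Lemma sd0 n s : sd n (fun=> 0) s = 0.
Proof.
elim: n s => [//|n IH] s /=.
by rewrite -[RHS](cobd0 s); apply: cobd_ext => r _ _; apply: IH.
Qed.

Lemma sd_sum n I (x : seq I) (W : I -> seq V -> F) s :
  sd n (fun r => \sum_(i <- x) W i r) s = \sum_(i <- x) sd n (W i) s.
Proof.
elim: n W s => [//|n IH] W s /=.
by rewrite -cobd_sum; apply: cobd_ext => r _ _; rewrite -IH.
Qed.

(** The same homotopy at the barycenter replaces [slice (b s) (cobd w)] by [w] minus a coboundary,
    which contributes only a double coboundary. *)
Lemma sd_cobd n w s : size s = n.+1 -> sd n.+1 (cobd w) s = cobd (sd n w) s.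
Proof.
elim: n w s => [|n IH] w s sz.
  case: s sz => [|v []] //= _.
  by rewrite /slice /= subr0.
rewrite [LHS]/=.
have -> : cobd (sd n.+1 (slice (b s) (cobd w))) s =
  cobd (fun r => sd n.+1 w r - cobd (sd n (slice (b s) w)) r) s.
  apply: cobd_ext => r _ szr.
  have -> : slice (b s) (cobd w) = fun r => w r - cobd (slice (b s) w) r by [].
  by rewrite sdB IH //; move: szr; rewrite sz => -[].
by rewrite (cobdB (sd n.+1 w)) cobdK subr0.
Qed.

End Subdivision.
End Cochains.

Definition pull (V V' : eqType) (F : Type) (f : V -> V') (w : seq V' -> F) : seq V -> F :=
  fun s => w (map f s).

Lemma cobd_pull (V V' : eqType) (F : comNzRingType) (f : V -> V') (w : seq V' -> F) :
  cobd (pull f w) = pull f (cobd w).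
Proof.
apply/funext => s; elim: s w => [//|v s IH] w /=.
by rewrite -[slice v _]/(pull f (slice (f v) w)) IH.
Qed.

Lemma sd_pull (V : eqType) (F : comNzRingType) (b : seq V -> V) (f : V -> V)
    n (w : seq V -> F) :
  (forall s, b (map f s) = f (b s)) -> sd b n (pull f w) = pull f (sd b n w).
Proof.
move=> bf; elim: n w => [//|n IH] w; apply/funext => s.
rewrite [LHS]/= [RHS]/pull /= bf.
rewrite -[RHS]/(pull f (cobd (sd b n (slice (f (b s)) w))) s) -cobd_pull.
by apply: cobd_ext => r _ _; rewrite -IH.
Qed.

(** * Alternating cochains on labels *)

Section Labels.
Variable p : nat.
Hypothesis p_pr : prime p.
Local Notation F := 'F_p.
Local Notation label := (nat * F)%type.
Implicit Types (w : seq label -> F) (s r : seq label) (a b : label) (c d : F)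
  (U : pred label).

Definition shift c a : label := (a.1, a.2 + c).

Lemma shiftD c d a : shift c (shift d a) = shift (c + d) a.
Proof. by rewrite /shift /= -addrA [d + c]addrC. Qed.

Lemma shift0 a : shift 0 a = a.
Proof. by case: a => l z; rewrite /shift /= addr0. Qed.

Lemma map_shiftD c d s : map (shift c) (map (shift d) s) = map (shift (c + d)) s.
Proof. by rewrite -map_comp; apply: eq_map => a; apply: shiftD. Qed.

Lemma map_shift0 s : map (shift 0) s = s.
Proof. by rewrite (eq_map shift0) map_id. Qed.

Definition Diff (V : eqType) (T : F -> V -> V) (w : seq V -> F) : seq V -> F :=
  fun s : seq V => pull (T 1) w s - w s.
Definition Norm (V : eqType) (T : F -> V -> V) (w : seq V -> F) : seq V -> F :=
  fun s : seq V => \sum_(c : F) pull (T c) w s.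

Fixpoint lowest a s : label :=
  if s is a' :: s' then
    let m := lowest a' s' in if (a.1 <= m.1)%N then a else m
  else a.

(** An equivariant choice of origin in a tuple. Taking it at the lowest level makes it independent
    of the order of the entries when levels are injective. *)
Definition base s : F := if s is a :: s' then (lowest a s').2 else 0.

Lemma lowest_shift c a s : lowest (shift c a) (map (shift c) s) = shift c (lowest a s).
Proof. by elim: s a => [//|a' s IH] a /=; rewrite IH /=; case: ifP. Qed.

Lemma base_shift c a s : base (map (shift c) (a :: s)) = base (a :: s) + c.
Proof. by rewrite /= lowest_shift. Qed.

Lemma lowest_mem a s : lowest a s \in a :: s.
Proof.
elim: s a => [|a' s IH] a /=; first exact: mem_head.
by case: ifP => _; rewrite in_cons ?eqxx // IH orbT.
Qed.

Lemma lowest_le a s x : x \in a :: s -> ((lowest a s).1 <= x.1)%N.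
Proof.
elim: s a x => [|a' s IH] a x /=; first by rewrite inE => /eqP ->.
rewrite in_cons => /predU1P [->|/IH le]; first by case: (leqP a.1 _) => // /ltnW.
by case: (leqP a.1 _) => // le2; apply: leq_trans le2 le.
Qed.

Definition injective_levels (U : pred label) :=
  {in U &, forall x y, x.1 = y.1 -> x = y}.

Lemma base_eqi (U : pred label) s r : injective_levels U -> all U s -> s =i r ->
  base s = base r.
Proof.
move=> iU Us E; have Ur : all U r by rewrite -(eq_all_r E).
case: s r Us Ur E => [|a s] [|b r] Us Ur E //.
- by have := E b; rewrite mem_head.
- by have := E a; rewrite mem_head.
rewrite /=; congr _.2; apply: iU.
- exact: (allP Us) (lowest_mem _ _).
- exact: (allP Ur) (lowest_mem _ _).
apply/eqP; rewrite eqn_leq !lowest_le //; [rewrite -E|rewrite E]; exact: lowest_mem.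
Qed.

(** Vanishing on repeats is a separate clause because the sign rule does not imply it when p = 2. *)
Definition alternating_on (U : pred label) k w :=
  (forall s1 a b s2, all U (s1 ++ a :: b :: s2) -> size (s1 ++ a :: b :: s2) = k ->
     w (s1 ++ a :: b :: s2) = - w (s1 ++ b :: a :: s2)) /\
  (forall s1 a s2, all U (s1 ++ a :: a :: s2) -> size (s1 ++ a :: a :: s2) = k ->
     w (s1 ++ a :: a :: s2) = 0).

(** The restriction to injective levels is what makes [base], and so [antidiff] and [antinorm],
    respect alternation. *)
Definition alternating k w := forall U, injective_levels U -> alternating_on U k w.

Lemma alternating_slice U k w a : U a ->
  alternating_on U k.+1 w -> alternating_on U k (slice a w).
Proof.
move=> Ua [w1 w2]; split=> [s1 x y s2|s1 x s2] Us sz.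
  by apply: (w1 (a :: s1)); rewrite /= ?Ua ?sz.
by apply: (w2 (a :: s1)); rewrite /= ?Ua ?sz.
Qed.

(** Deleting an entry outside the adjacent pair leaves the pair to [w]. The two terms that delete an
    entry of the pair have opposite signs; a swap exchanges them, and on a repeat they cancel. *)
Lemma alternating_cobd U k w : alternating_on U k w -> alternating_on U k.+1 (cobd w).
Proof.
move=> wU; split.
  move=> s1 a b s2; elim: s1 k w wU => [|c s1 IH] k w wU /=.
    move=> /and3P [Ua Ub Us] [sz].
    suff -> : cobd (slice b (slice a w)) s2 = - cobd (slice a (slice b w)) s2.
      by rewrite /slice; ring.
    rewrite -cobdN; apply: cobd_ext => r rs szr.
    have [w1 _] := wU; apply: (w1 [::]) => /=; last by rewrite szr.
    by rewrite Ua Ub; apply/allP => x /(mem_subseq rs)/(allP Us).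
  move=> /andP [Uc Us] [sz]; rewrite (proj1 wU) //.
  case: k sz wU => [|k] sz wU; first by move: sz; rewrite size_cat /= addnS.
  by rewrite (IH k) //; [ring | exact: alternating_slice].
move=> s1 a s2; elim: s1 k w wU => [|c s1 IH] k w wU /=.
  move=> /and3P [Ua _ Us] [sz].
  suff -> : cobd (slice a (slice a w)) s2 = 0 by rewrite /slice; ring.
  rewrite -[RHS](cobd0 _ s2); apply: cobd_ext => r rs szr.
  have [_ w2] := wU; apply: (w2 [::]) => /=; last by rewrite szr.
  by rewrite Ua; apply/allP => x /(mem_subseq rs)/(allP Us).
move=> /andP [Uc Us] [sz]; rewrite (proj2 wU) //.
case: k sz wU => [|k] sz wU; first by move: sz; rewrite size_cat /= addnS.
by rewrite (IH k) //; [ring | exact: alternating_slice].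
Qed.

Lemma alternating_repeat U k w s1 a s2 s3 : alternating_on U k w ->
  all U (s1 ++ a :: s2 ++ a :: s3) -> size (s1 ++ a :: s2 ++ a :: s3) = k ->
  w (s1 ++ a :: s2 ++ a :: s3) = 0.
Proof.
move=> wU; elim: s2 s1 => [|c s2 IH] s1 Us sz; first exact: (proj2 wU).
rewrite (proj1 wU) // -cat_rcons IH ?oppr0 //.
  by move: Us; rewrite cat_rcons !all_cat /= => /and4P [-> -> -> ->].
by rewrite -sz cat_rcons !size_cat.
Qed.

Lemma alternating_not_injective U k w s : alternating_on U k w ->
  injective_levels U -> all U s -> size s = k -> ~~ uniq (map fst s) -> w s = 0.
Proof.
move=> wU iU; elim: s k w wU => [//|x s IH] k w wU /= /andP [Ux Us].
case: k wU => [//|k] wU [sz].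
rewrite negb_and negbK; case/orP => [/mapP [y ys xy]|nu]; last first.
  exact: (IH k (slice x w) (alternating_slice Ux wU)).
have {}xy : x = y by apply: iU => //; exact: (allP Us).
move: Us sz; rewrite -xy in ys; case/splitPr: ys => s2 s3 Us sz.
by apply: (alternating_repeat (s1 := [::]) wU); rewrite /= ?Ux ?sz.
Qed.

(** A discrete integral: the sum of [w] over the translates of [s] whose base is 0, ..., [base s] -
    1. *)
Definition antidiff w s : F :=
  \sum_(j < base s) w (map (shift (j%:R - base s)) s).
(** Restriction to the fundamental domain of tuples with base 0. *)
Definition antinorm w s : F := if base s == 0 then w s else 0.

(** The sum telescopes: translation by 1 appends the term of index [base s], which is [w s]. *)
Lemma antidiffK w s : Norm shift w s = 0 -> s != [::] ->
  Diff shift (antidiff w) s = w s.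
Proof.
case: s => [//|a s] nw _; rewrite /Diff /pull /antidiff base_shift.
set z := base (a :: s).
pose u j := w (map (shift (j%:R - z)) (a :: s)).
have uz : u z = w (a :: s) by rewrite /u natr_Zp subrr map_shift0.
have su : \sum_(j < p) u j = 0.
  have castu n : n = p -> \sum_(j < n) u j = \sum_(j < p) u j by move=> ->.
  rewrite -(castu _ (Fp_cast p_pr)) -[RHS]nw /Norm /pull.
  rewrite [RHS](reindex_inj (addIr (- z))) /=.
  by apply: eq_bigr => c _; rewrite /u natr_Zp.
have -> : \sum_(j < (z + 1)%R) w (map (shift (j%:R - (z + 1))) (map (shift 1) (a :: s)))
    = \sum_(j < (z + 1)%R) u j.
  apply: eq_bigr => j _; rewrite map_shiftD /u; congr (w (map (shift _) _)); ring.
rewrite -uz; pose S n := \sum_(j < n) u j.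
have {}su n : n = p -> S n = 0 by move=> ->.
have S_rec n : S n.+1 = S n + u n by rewrite /S big_ord_recr.
rewrite -/(S z) -/(S (z + 1)).
have ltzp : (z < p)%N by rewrite -[X in (_ < X)%N](Fp_cast p_pr) ltn_ord.
have val_z1 : ((z + 1)%R : nat) = ((z : nat).+1 %% p)%N.
  by rewrite -(val_Fp_nat p_pr) -{1}[z]natr_Zp -natr1.
(* At the wrap-around z + 1 = p the translated base is 0 and its sum is empty; the vanishing norm
   says that all p terms sum to zero, so [- S z = u z]. *)
have [zp|zp] := eqVneq (z : nat).+1 p.
  move: (su _ zp); rewrite S_rec val_z1 zp modnn /S big_ord0 -/(S z) => /eqP.
  by rewrite addr_eq0 => /eqP ->; rewrite opprK add0r.
by rewrite val_z1 modn_small ?S_rec; [rewrite addrAC subrr add0r | lia].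
Qed.

(** Exactly one translate of [s] has base 0, and by invariance [w] takes the value [w s] there. *)
Lemma antinormK w s : Diff shift w =1 (fun=> 0) -> s != [::] -> Norm shift (antinorm w) s = w s.
Proof.
case: s => [//|a s] dw _; rewrite /Norm /pull /antinorm.
under eq_bigr => c _ do rewrite base_shift.
rewrite -big_mkcond /= (big_pred1 (- base (a :: s))) => [|c]; last first.
  by rewrite addrC addr_eq0.
have inv r : w (map (shift 1) r) = w r by apply/eqP; rewrite -subr_eq0; apply/eqP/dw.
have invn n r : w (map (shift n%:R) r) = w r.
  elim: n r => [|n IH] r; first by rewrite map_shift0.
  by rewrite mulrS -map_shiftD inv IH.
by have := invn (nat_of_ord (- base (a :: s))) (a :: s); rewrite natr_Zp.
Qed.

Lemma injective_levels_shift c U : injective_levels U ->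
  injective_levels [pred x | U (shift c x)].
Proof.
move=> iU x y Ux Uy xy; have : shift c x = shift c y by apply: iU.
move/(congr1 (shift (- c))); rewrite !shiftD addNr !shift0.
by [].
Qed.

Lemma alternating_shift U k w c : injective_levels U -> alternating k w ->
  alternating_on U k (pull (shift c) w).
Proof.
move=> iU wk; have [w1 w2] := wk _ (injective_levels_shift (c := - c) iU).
have allE s : all [pred x | U (shift (- c) x)] (map (shift c) s) = all U s.
  by rewrite all_map; apply: eq_all => x /=; rewrite shiftD addNr shift0.
split=> [s1 a b s2|s1 a s2] Us sz; rewrite /pull !map_cat /=.
  by apply: w1; rewrite -?sz ?size_cat /= ?size_map // -[_ :: _ :: _]/(map _ (a :: b :: s2)) -map_cat allE.
by apply: w2; rewrite -?sz ?size_cat /= ?size_map // -[_ :: _ :: _]/(map _ (a :: a :: s2)) -map_cat allE.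
Qed.

Lemma base_swap U s1 a b s2 : injective_levels U -> all U (s1 ++ a :: b :: s2) ->
  base (s1 ++ a :: b :: s2) = base (s1 ++ b :: a :: s2).
Proof.
move=> iU Us; apply: (base_eqi iU Us) => x.
by rewrite !mem_cat !in_cons; congr (_ || _); rewrite orbCA.
Qed.

Lemma alternating_antidiff k w : alternating k w -> alternating k (antidiff w).
Proof.
move=> wk U iU; have wU c := alternating_shift c iU wk.
split=> [s1 a b s2|s1 a s2] Us sz; rewrite /antidiff.
  rewrite (base_swap iU Us) -sumrN; apply: eq_bigr => j _.
  exact: (proj1 (wU _)).
by rewrite big1 // => j _; exact: (proj2 (wU _)).
Qed.

Lemma alternating_antinorm k w : alternating k w -> alternating k (antinorm w).
Proof.
move=> wk U iU; have [w1 w2] := wk U iU.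
split=> [s1 a b s2|s1 a s2] Us sz; rewrite /antinorm.
  by rewrite (base_swap iU Us); case: ifP; rewrite ?oppr0 // w1.
by case: ifP => // _; exact: w2.
Qed.

Section Equivariance.
Variables (V : eqType) (T : F -> V -> V).
Implicit Types u : seq V -> F.

Lemma cobd_Diff u : cobd (Diff T u) = Diff T (cobd u).
Proof.
apply/funext => s; rewrite /Diff -cobd_pull.
exact: (cobdB (pull (T 1) u) u).
Qed.

Lemma cobd_Norm u : cobd (Norm T u) = Norm T (cobd u).
Proof.
apply/funext => s; rewrite /Norm.
rewrite (cobd_sum _ (fun c => pull (T c) u)); apply: eq_bigr => c _.
by rewrite cobd_pull.
Qed.

(** The operators of the periodic resolution of the cyclic group, with the identity in degree 0,
    that of the empty tuple. *)
Definition nu k u : seq V -> F :=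
  if k is 0 then u else if odd k then Diff T u else Norm T u.

Lemma cobd_nu k u : cobd (nu k u) = nu k (cobd u).
Proof. by case: k => [//|k]; rewrite /nu; case: ifP => _; rewrite (cobd_Diff, cobd_Norm). Qed.

Hypothesis TD : forall c d x, T c (T d x) = T (c + d) x.

Lemma Diff_Norm u (s : seq V) : Diff T (Norm T u) s = 0.
Proof.
rewrite /Diff /Norm {1}/pull (reindex_inj (addIr (-1))) /= -sumrB big1 // => c _.
by rewrite /pull -map_comp (eq_map (g := T c)) ?subrr // => x /=; rewrite TD subrK.
Qed.

Lemma Norm_Diff u (s : seq V) : Norm T (Diff T u) s = 0.
Proof.
rewrite /Diff /Norm /pull sumrB (reindex_inj (addIr (-1))) /= -sumrB big1 // => c _.
rewrite -map_comp (eq_map (g := T c)) ?subrr // => x /=.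
by rewrite TD addrC subrK.
Qed.

Lemma nu_nu k u (s : seq V) : (k == 0%N -> s = [::]) -> nu k (nu k.+1 u) s = 0.
Proof.
case: k => [->//|k _]; first by rewrite /nu /= /Diff /pull /= subrr.
by rewrite /nu /=; case: odd => /=; [exact: Norm_Diff|exact: Diff_Norm].
Qed.

End Equivariance.

Fixpoint alpha k : seq label -> F :=
  if k is k'.+1 then
    if odd k then antidiff (cobd (alpha k')) else antinorm (cobd (alpha k'))
  else fun=> 1.

(** Solving for the next cochain requires the complementary operator to kill [cobd (alpha k)]. In
    degree 0 this is the norm of a constant, a multiple of p; afterwards the operator commutes with
    [cobd], and the previous relation turns the expression into a double coboundary. *)
Lemma nu_alpha k : nu shift k.+1 (alpha k.+1) = cobd (alpha k).
Proof.
have step n : (if odd n then Diff shift (cobd (alpha n)) else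
      Norm shift (cobd (alpha n))) =1 (fun=> 0) ->
    nu shift n.+1 (alpha n.+1) = cobd (alpha n).
  rewrite /nu [alpha n.+1]/= [odd n.+1]/=; case: (odd n) => /= E; apply/funext => s.
    case: s => [|a s]; last exact: antinormK.
    by rewrite /Norm /pull big1 // => c _; rewrite /antinorm; case: ifP.
  case: s => [|a s]; last by rewrite antidiffK // E.
  by rewrite /Diff /pull subrr.
elim: k => [|k IH]; apply: step => s.
  rewrite /= -cobd_Norm /Norm /pull sumr_const card_Fp // -[_ *+ p]mulr_natr.
  by rewrite pchar_Fp_0 // mulr0; exact: cobd0.
rewrite -cobd_Diff -cobd_Norm; move: IH; rewrite /nu.
by case: ifP => _ ->; rewrite cobdK.
Qed.

Lemma alternating_alpha k : alternating k (alpha k).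
Proof.
elim: k => [|k IH]; first by move=> U _; split=> [[|? ?]|[|? ?]].
have {}IH : alternating k.+1 (cobd (alpha k)).
  by move=> U iU; apply: alternating_cobd; exact: IH.
by rewrite /=; case: ifP => _; [exact: alternating_antidiff|exact: alternating_antinorm].
Qed.

End Labels.

(** * Pairing the cone chains with pulled-back cochains *)

Section Labelling.
Variable p : nat.
Hypothesis p_pr : prime p.
Local Notation F := 'F_p.
Local Notation label := (nat * F)%type.

Variables (V : eqType) (T : F -> V -> V).
Hypothesis T0 : forall x, T 0 x = x.
Hypothesis TD : forall c d x, T c (T d x) = T (c + d) x.

Variable vertex : nat -> V.

(* [ev k] is a chain of dimension k - 1: the cone from [vertex k] on the
   [nu]-multiple of the previous chain. *)
Fixpoint ev k (w : seq V -> F) : F :=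
  if k is k'.+1 then ev k' (nu T k' (slice (vertex k') w)) else w [::].

Variables (N : nat) (simp : nat -> seq V -> Prop).
Hypothesis simp_cone : forall k s c, (k <= N)%N ->
  simp k s -> size s = k -> simp k.+1 (vertex k :: map (T c) s).
Hypothesis simp_nil : simp 0 [::].

(** The chain is supported on the tuples that iterated cones over translates produce, and [simp] is
    closed under these. *)
Lemma ev_ext k w1 w2 : (k <= N.+1)%N ->
  (forall s, simp k s -> size s = k -> w1 s = w2 s) -> ev k w1 = ev k w2.
Proof.
elim: k w1 w2 => [|k IH] w1 w2 kN E /=; first exact: E.
have ES s c : simp k s -> size s = k ->
    pull (T c) (slice (vertex k) w1) s = pull (T c) (slice (vertex k) w2) s.
  move=> ks sz; rewrite /pull /slice.
  by apply: E; rewrite /= ?size_map ?sz //; exact: simp_cone.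
have ES0 s : simp k s -> size s = k ->
    slice (vertex k) w1 s = slice (vertex k) w2 s.
  by move=> ks sz; have := ES s 0 ks sz; rewrite /pull (eq_map T0) map_id.
apply: (IH _ _ (ltnW kN)) => s ks sz; rewrite /nu.
case: k ks sz {IH E kN} => [|k] ks sz in ES ES0 *; first exact: ES0.
case: ifP => _; first by rewrite /Diff ES // ES0.
by rewrite /Norm; apply: eq_bigr => c _; rewrite ES.
Qed.

Lemma nuB k w1 w2 :
  nu T k (fun s => w1 s - w2 s) = (fun s => nu T k w1 s - nu T k w2 s).
Proof.
apply/funext => s; rewrite /nu; case: k => [//|k]; case: ifP => _.
  by rewrite /Diff /pull; ring.
by rewrite /Norm -sumrB.
Qed.

Lemma evB k w1 w2 : ev k (fun s => w1 s - w2 s) = ev k w1 - ev k w2.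
Proof. by elim: k w1 w2 => [//|k IH] w1 w2 /=; rewrite -IH -nuB. Qed.

Lemma ev0 k : ev k (fun=> 0) = 0.
Proof. by have := evB k (fun=> 0) (fun=> 0); rewrite !subrr. Qed.

(** The dual form of: the boundary of c_(k+1) is nu_k c_k. The cone homotopy at [vertex k] gives the
    main term; the remaining one contains two consecutive operators [nu] and vanishes. *)
Lemma ev_cobd k w : ev k.+1 (cobd w) = ev k (nu T k w).
Proof.
elim: k w => [|k IH] w; first by rewrite /= /slice /= subr0.
rewrite -[LHS]/(ev k.+1 (nu T k.+1 (slice (vertex k.+1) (cobd w)))).
have -> : slice (vertex k.+1) (cobd w) =
  fun r => w r - cobd (slice (vertex k.+1) w) r by [].
rewrite nuB evB -cobd_nu IH; set u := slice _ w.
suff -> : ev k (nu T k (nu T k.+1 u)) = 0 by rewrite subr0.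
case: k u {IH} => [|k] u; first by rewrite /= /nu /= /Diff /pull /= subrr.
rewrite -[RHS](ev0 k.+1); congr ev; apply/funext => s.
exact: (nu_nu TD).
Qed.

Variable bary : seq V -> V.
Hypothesis baryT : forall c s, bary (map (T c) s) = T c (bary s).
Hypothesis simp_flag : forall k s s',
  simp k s -> size s = k -> flag bary k s s' -> simp k s'.

Variable lab : V -> label.
Hypothesis labT : forall k s c x, simp k s -> size s = k -> x \in s ->
  lab (T c x) = shift c (lab x).

Fixpoint iflag m k s s' : Prop :=
  if m is m'.+1 then exists r, flag bary k s r /\ iflag m' k r s' else s' = s.

Lemma iflag_simp m k s s' : simp k s -> size s = k -> iflag m k s s' ->
  simp k s' /\ size s' = k.
Proof.
elim: m s => [|m IH] s ks sz /=; first by move=> ->.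
case=> r [fr]; apply: IH; first exact: simp_flag fr.
exact: flag_size fr.
Qed.

Definition isd m k (w : seq V -> F) := iter m (sd bary k) w.

Lemma isd_ext m k w1 w2 s : size s = k ->
  (forall s', iflag m k s s' -> w1 s' = w2 s') -> isd m k w1 s = isd m k w2 s.
Proof.
elim: m s => [|m IH] s sz E; first exact: E.
rewrite /isd !iterS; apply: sd_ext => // r fr; apply: IH; first exact: flag_size fr.
by move=> s' fs; apply: E; exists r.
Qed.

Lemma nu_isd m k n w : nu T k (isd m n w) = isd m n (nu T k w).
Proof.
elim: m => [//|m IH]; rewrite /isd !iterS -!/(isd _ _ _) -IH.
set u := isd m n w; rewrite /nu; case: k {IH} => [//|k]; case: ifP => _.
  apply/funext => s; rewrite /Diff -(sd_pull (f := T 1)) //.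
  by rewrite -sdB.
apply/funext => s; rewrite /Norm (sd_sum _ _ _ (fun c => pull (T c) u)).
by apply: eq_bigr => c _; rewrite -sd_pull.
Qed.

Lemma isd_cobd m n w s : size s = n.+1 ->
  isd m n.+1 (cobd w) s = cobd (isd m n w) s.
Proof.
elim: m s => [//|m IH] s sz; rewrite /isd !iterS -!/(isd _ _ _) -sd_cobd //.
apply: sd_ext => // r fr; apply: IH; exact: flag_size fr.
Qed.

Lemma no_fine_labelling m :
  (forall s s', simp N.+1 s -> size s = N.+1 -> iflag m N.+1 s s' ->
    {in s' &, forall x y, (lab x).1 = (lab y).1 -> lab x = lab y} /\
    {in s', forall x, ((lab x).1 < N)%N}) -> False.
Proof.
move=> fine; pose A k := isd m k (pull lab (@alpha p k)).
(* Labels are equivariant on every tuple of the subdivision, so the relation between consecutive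
   [alpha] survives pullback and subdivision. *)
have A_rel k s : simp k.+1 s -> size s = k.+1 -> nu T k.+1 (A k.+1) s = cobd (A k) s.
  move=> ks sz; rewrite /A nu_isd -isd_cobd // cobd_pull -nu_alpha //.
  apply: isd_ext => // s' /(iflag_simp ks sz) [ks' sz'].
  have mapT c : map lab (map (T c) s') = map (shift c) (map lab s').
    by rewrite -!map_comp; apply/eq_in_map => x xs /=; rewrite (labT c ks').
  rewrite /nu; case: ifP => _.
    by rewrite /Diff /pull mapT.
  by rewrite /Norm; apply: eq_bigr => c _; rewrite /pull mapT.
(* Alternating [ev_cobd] with [A_rel] descends to the value of [alpha 0] on the empty tuple. *)
have ev1 k : (k <= N)%N -> ev k.+1 (cobd (A k)) = 1.
  elim: k => [|k IH] kN.
    by rewrite ev_cobd /= /A /isd; elim: (m) => //= n ->.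
  rewrite ev_cobd -(IH (ltnW kN)); apply: ev_ext => [|s ks sz]; first exact: ltnW.
  by rewrite A_rel.
have /eqP := ev1 N (leqnn N); rewrite (@ev_ext _ _ (fun=> 0)) => [||s ks sz] //.
  by rewrite ev0 eq_sym oner_eq0.
rewrite -isd_cobd // cobd_pull -[RHS](_ : isd m N.+1 (fun=> 0) s = 0); last first.
  rewrite /isd; elim: m s {ks sz fine A A_rel ev1} => [//|n IH] s.
  rewrite iterS -[RHS](sd0 F bary N.+1 s); congr sd; apply/funext; exact: IH.
apply: isd_ext => // s' fs; have [inj lt] := fine _ _ ks sz fs.
have [ks' sz'] := iflag_simp ks sz fs.
have inj_l : injective_levels [pred x | x \in map lab s'].
  move=> _ _ /mapP [x xs ->] /mapP [y ys ->]; exact: inj.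
have alt := alternating_cobd (alternating_alpha N inj_l).
(* There are N + 1 labels and only N levels, so two labels share a level. *)
rewrite /pull; apply: (alternating_not_injective alt inj_l); first exact/allP.
  by rewrite size_map.
apply/negP => un; have : (size (map fst (map lab s')) <= size (iota 0 N))%N.
  apply: uniq_leq_size => // l; rewrite mem_iota add0n -map_comp => /mapP [x xs ->].
  exact: lt.
by rewrite size_iota !size_map sz' ltnn.
Qed.

End Labelling.

Local Open Scope classical_set_scope.

(** * The iterated join of the group and its map to the total space *)

Lemma cvg_mx (T : Type) (F : set_system T) (R : topologicalType) m n
    (f : T -> 'M[R]_(m, n)) (M : 'M[R]_(m, n)) : Filter F ->
  (forall i j, f x i j @[x --> F] --> M i j) -> f @ F --> M.
Proof.
move=> FF fM A [P MP PA].
have : \forall x \near F, forall i j, P i j (f x i j).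
  apply: filter_forall => i; apply: filter_forall => j; exact: (fM i j _ (MP i j)).
by apply: filterS => x; exact: PA.
Qed.

Lemma cvg_sumr (T : Type) (F : set_system T) (R : realType) I (r : seq I)
    (f : I -> T -> R) (l : I -> R) : Filter F ->
  (forall i, f i x @[x --> F] --> l i) ->
  \sum_(i <- r) f i x @[x --> F] --> \sum_(i <- r) l i.
Proof.
move=> FF fl; elim: r => [|i r IH].
  by rewrite big_nil; under eq_fun do rewrite big_nil; exact: cvg_cst.
rewrite big_cons; under eq_fun do rewrite big_cons.
exact: cvgD (fl i) IH.
Qed.

Lemma cvg_minr (T : Type) (F : set_system T) (R : realType)
    (f g : T -> R) (a b : R) : Filter F ->
  f x @[x --> F] --> a -> g x @[x --> F] --> b ->
  Num.min (f x) (g x) @[x --> F] --> Num.min a b.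
Proof.
move=> FF fa gb; apply: (@continuous2_cvg _ R R R _ _ f g Num.min) fa gb.
exact: (@min_continuous _ R (a, b)).
Qed.

Lemma cvg_withinW (X Y : topologicalType) (f : X -> Y) (D : set X) x :
  {for x, continuous f} -> f @ within D (nbhs x) --> f x.
Proof. by apply: cvg_trans; apply: cvg_fmap2; exact: cvg_within. Qed.

(* MathComp states these for actions on finite types only. *)
Section TotalAction.
Variables (gT : finGroupType) (X : Type) (to : {action gT &-> X}).

Lemma total_actM x g h : to x (g * h)%g = to (to x g) h.
Proof. by case: to => a [_ aM] /=; apply: aM; rewrite inE. Qed.

Lemma total_act1 x : to x 1%g = x.
Proof.
have : injective (to^~ 1%g) by case: to => a [] /= inj _ ; apply: inj.
by apply; rewrite /= -total_actM mulg1.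
Qed.

Lemma total_actK x g : to (to x g) g^-1%g = x.
Proof. by rewrite -total_actM mulgV total_act1. Qed.

Lemma total_actKV x g : to (to x g^-1%g) g = x.
Proof. by rewrite -total_actM mulVg total_act1. Qed.

End TotalAction.

Section Join.
Variables (R : realType) (gT : finGroupType).
Local Notation nG := #|[set: gT]%G|.
Implicit Types (g h : gT).

Definition idx g : 'I_nG := gring_index [set: gT]%G g.

Lemma idx_inj : injective idx.
Proof. by move=> g h /(congr1 enum_val); rewrite !gring_indexK ?inE. Qed.

Lemma idx_onto j : exists g, j = idx g.
Proof. by exists (enum_val j); rewrite /idx gring_valK. Qed.

Lemma regular_actE k (M : 'M[R]_(k, nG)) g i h :
  regular_act M g i (idx h) = M i (idx (h * g^-1)%g).
Proof.
rewrite /regular_act mxE (bigD1 (idx (h * g^-1)%g)) //= big1 ?addr0 => [|j nj].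
  by rewrite mxE gring_indexK ?inE // mulgKV /idx mxE !eqxx mulr1.
have [h' e] := idx_onto j; rewrite {}e in nj *.
rewrite mxE /idx gring_indexK ?inE // mxE eqxx /= -!/(idx _).
case: eqVneq => [/idx_inj e|]; last by rewrite mulr0.
by move: nj; rewrite e mulgK eqxx.
Qed.

Lemma regular_actM k (M : 'M[R]_(k, nG)) g h :
  regular_act (regular_act M g) h = regular_act M (g * h)%g.
Proof.
apply/matrixP => i j; have [h' ->] := idx_onto j.
by rewrite !regular_actE invMg mulgA.
Qed.

Lemma regular_act1 k (M : 'M[R]_(k, nG)) : regular_act M 1%g = M.
Proof.
apply/matrixP => i j; have [h ->] := idx_onto j.
by rewrite regular_actE invg1 mulg1.
Qed.

Lemma regular_actK k (M : 'M[R]_(k, nG)) g :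
  regular_act (regular_act M g) g^-1%g = M.
Proof. by rewrite regular_actM mulgV regular_act1. Qed.

Lemma sum_idx (f : 'I_nG -> R) : \sum_j f j = \sum_g f (idx g).
Proof.
rewrite (reindex idx) //; exists enum_val => j _; last by rewrite /idx gring_valK.
by rewrite /idx gring_indexK ?inE.
Qed.

Variable N : nat.
Local Notation space := 'M[R]_(N.+1, nG).
Implicit Types (M x : space).

(** Matrix coordinates on the join: a nonzero row has a single nonzero entry, whose column is the
    group element in that copy and whose value is its weight. *)
Definition join : set space := [set M | [/\ forall i j, 0 <= M i j,
  \sum_i \sum_j M i j = 1 &
  forall i j j', M i j != 0 -> M i j' != 0 -> j = j']].

Lemma join_act M g : join M -> join (regular_act M g).
Proof.
move=> [M0 M1 Mu]; split.
- by move=> i j; have [h ->] := idx_onto j; rewrite regular_actE.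
- rewrite -M1; apply: eq_bigr => i _; rewrite !sum_idx (reindex_inj (mulIg g)) /=.
  by apply: eq_bigr => h _; rewrite regular_actE mulgK.
move=> i j j'; have [h ->] := idx_onto j; have [h' ->] := idx_onto j'.
by rewrite !regular_actE => /Mu e /e /idx_inj /mulIg ->.
Qed.

Definition weight M k := \sum_j M (inord k) j.
Definition weight_below M k := \sum_(i < k) weight M i.

Lemma weight_belowS M k : weight_below M k.+1 = weight_below M k + weight M k.
Proof. by rewrite /weight_below big_ord_recr. Qed.

Lemma weight_ge0 M k : join M -> 0 <= weight M k.
Proof. by case=> M0 _ _; apply: sumr_ge0. Qed.

Lemma weight_below_ge0 M k : join M -> 0 <= weight_below M k.
Proof. by move=> jM; apply: sumr_ge0 => i _; apply: weight_ge0. Qed.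

Lemma weight_act M k g : weight (regular_act M g) k = weight M k.
Proof.
rewrite /weight !sum_idx (reindex_inj (mulIg g)) /=.
by apply: eq_bigr => h _; rewrite regular_actE mulgK.
Qed.

Lemma weight_below_act M k g : weight_below (regular_act M g) k = weight_below M k.
Proof. by apply: eq_bigr => i _; rewrite weight_act. Qed.

Lemma weight_below_top M : join M -> weight_below M N.+1 = 1.
Proof.
case=> _ <- _; apply: eq_bigr => i _; apply: eq_bigr => j _.
by rewrite inord_val.
Qed.

(** The value 1 on a zero row is a placeholder. *)
Definition letter M k : gT :=
  if [pick g | M (inord k) (idx g) != 0] is Some g then g else 1%g.

Lemma letterP M k : 0 < weight M k -> M (inord k) (idx (letter M k)) != 0.
Proof.
rewrite /letter; case: pickP => //= e; rewrite /weight sum_idx big1 ?ltxx // => g _.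
by have /negbFE/eqP := e g.
Qed.

Lemma letter_eq M k g : join M -> M (inord k) (idx g) != 0 -> letter M k = g.
Proof.
case=> _ _ Mu Mg; rewrite /letter; case: pickP => [h|/(_ g)]; last by rewrite Mg.
by move=> /Mu -/(_ _ Mg)/idx_inj.
Qed.

Lemma letter_act M k g : join M -> 0 < weight M k ->
  letter (regular_act M g) k = (letter M k * g)%g.
Proof.
move=> jM w0; apply: letter_eq; first exact: join_act.
by rewrite regular_actE mulgK letterP.
Qed.

Lemma weight_continuous k x : {for x, continuous (weight^~ k)}.
Proof. by apply: (cvg_sumr (nbhs_filter x)) => j; exact: coord_continuous. Qed.

Lemma weight_below_continuous k x : {for x, continuous (weight_below^~ k)}.
Proof. by apply: (cvg_sumr (nbhs_filter x)) => j; exact: weight_continuous. Qed.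

Lemma letter_near x k : join x -> 0 < weight x k ->
  \forall M \near within join (nbhs x), letter M k = letter x k.
Proof.
move=> jx w0; have nz := letterP w0.
have pos : 0 < x (inord k) (idx (letter x k)) by rewrite lt0r nz /=; case: jx => ->.
have : \forall M \near nbhs x, 0 < (M : space) (inord k) (idx (letter x k)).
  exact: (@cvgr_gt R _ (nbhs x) (nbhs_filter x) _ _
    (@coord_continuous R _ _ (inord k) (idx (letter x k)) x) 0 pos).
move=> nM; rewrite /within /=; apply: filterS nM => M Mp jM.
by apply: letter_eq => //; rewrite gt_eqF.
Qed.

Section ToContractible.
Variables (X : topologicalType) (to : {action gT &-> X}).
Hypothesis act_cont : forall g, continuous (fun y => to y g).
Variables (x0 : X) (H : X * R -> X).
Hypothesis H_cont : {within [set: X] `*` `[0, 1], continuous H}.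
Hypothesis H0 : forall y, H (y, 0) = y.
Hypothesis H1 : forall y, H (y, 1) = x0.

(* Being locally equal to 1 where the lower rows vanish makes [classify]
   continuous there. *)
Definition cone_time M k : R :=
  Num.min 1 (2 * weight M k / weight_below M k.+1).

(** Row [k'] is attached by the contraction conjugated by its letter [g]: time 0 keeps the map of
    the lower rows, time 1 gives [to x0 g]. Conjugation makes the cone equivariant. *)
Fixpoint classify k M : X :=
  if k is k'.+1 then
    let g := letter M k' in to (H (to (classify k' M) g^-1%g, cone_time M k')) g
  else x0.

Lemma cone_time_in M k : join M -> 0 <= cone_time M k <= 1.
Proof.
move=> jM; rewrite /cone_time ge_min lexx /= andbT le_min ler01 /=.
by rewrite divr_ge0 ?mulr_ge0 ?weight_ge0 ?weight_below_ge0.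
Qed.

Lemma cone_time1 M k : join M -> weight_below M k <= weight M k ->
  0 < weight M k -> cone_time M k = 1.
Proof.
move=> jM le w0; rewrite /cone_time weight_belowS min_l //.
have b0 := weight_below_ge0 k jM.
by rewrite ler_pdivlMr; lra.
Qed.

Lemma cone_time0 M k : weight M k = 0 -> cone_time M k = 0.
Proof. by move=> w0; rewrite /cone_time w0 mulr0 mul0r min_r. Qed.

Lemma cone_time_act M k g : cone_time (regular_act M g) k = cone_time M k.
Proof. by rewrite /cone_time weight_act weight_below_act. Qed.

Lemma classify_act k M g : join M -> 0 < weight_below M k ->
  classify k (regular_act M g) = to (classify k M) g.
Proof.
move=> jM; elim: k => [|k IH]; first by rewrite /weight_below big_ord0 ltxx.
rewrite weight_belowS /= cone_time_act => w0.
have [wk|wk] := eqVneq (weight M k) 0.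
  rewrite cone_time0 // !H0 !total_actKV IH //; by rewrite wk addr0 in w0.
have {}wk : 0 < weight M k by rewrite lt0r wk weight_ge0.
rewrite letter_act // total_actM; congr (to (to _ _) _).
(* Without weight below, induction says nothing about the lower map, but the contraction is then at
   time 1 and forgets it. *)
have [bk|bk] := eqVneq (weight_below M k) 0; last first.
  by rewrite IH ?lt0r ?bk ?weight_below_ge0 // invMg total_actM total_actK.
by rewrite cone_time1 ?bk ?ltW // !H1.
Qed.

Lemma classify_cvg k x : join x -> 0 < weight_below x k ->
  classify k M @[M --> within join (nbhs x)] --> classify k x.
Proof.
move=> jx; have FF : Filter (within join (nbhs x)) by exact: within_filter.
have wcvg j : weight M j @[M --> within join (nbhs x)] --> weight x j.
  exact: (@cvg_withinW space R (weight^~ j) join x (@weight_continuous j x)).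
have bcvg j : weight_below M j @[M --> within join (nbhs x)] --> weight_below x j.
  exact: (@cvg_withinW space R (weight_below^~ j) join x (@weight_below_continuous j x)).
elim: k => [|k IH]; first by rewrite /weight_below big_ord0 ltxx.
move=> b1; pose Q g M := to (H (to (classify k M) g^-1%g, cone_time M k)) g.
(* If the lower rows vanish at [x], the cone time is 1 near [x] and the map is locally constant on
   the join. *)
have [bk|bk] := eqVneq (weight_below x k) 0.
  have wk : 0 < weight x k by move: b1; rewrite weight_belowS bk add0r.
  have E M : join M -> letter M k = letter x k -> weight_below M k <= weight M k ->
      0 < weight M k -> classify k.+1 M = to x0 (letter x k).
    by move=> jM lM le w0; rewrite /= lM cone_time1 // H1.
  have lt_near : \forall M \near within join (nbhs x), weight_below M k < weight M k.
    have lt0 : 0 < weight x k - weight_below x k by rewrite bk subr0.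
    have := @cvgr_gt R _ _ FF _ _ (cvgB (wcvg k) (bcvg k)) 0 lt0.
    move=> lt1; near=> M; rewrite -subr_gt0; near: M; exact: lt1.
  rewrite E ?bk ?weight_ge0 //.
  apply: (@cvg_trans _ ((fun=> to x0 (letter x k)) @ within join (nbhs x))); last exact: cvg_cst.
  apply: near_eq_cvg; near=> M.
  rewrite E //.
  - near: M; exact: withinT.
  - by near: M; exact: letter_near.
  - by apply: ltW; near: M.
  - by near: M; exact: (@cvgr_gt R _ _ FF _ _ (wcvg k)).
have {}bk : 0 < weight_below x k by rewrite lt0r bk weight_below_ge0.
have Qcvg g : Q g M @[M --> within join (nbhs x)] --> Q g x.
  apply: (@cvg_comp _ _ _ (fun M => H (to (classify k M) g^-1%g, cone_time M k))
    (fun y => to y g) _ (nbhs (H (to (classify k x) g^-1%g, cone_time x k)))); last first.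
    exact: act_cont.
  pose B := [set: X] `*` `[0, 1 : R].
  have Bin M : join M -> B (to (classify k M) g^-1%g, cone_time M k).
    by move=> jM; split => //=; rewrite in_itv /=; exact: cone_time_in.
  have Hc := (subspace_continuousP _ _).1 H_cont _ (Bin x jx).
  apply: cvg_comp Hc => W; rewrite nbhs_simpl /= /within /= => nW.
  have pair_cvg : (to (classify k M) g^-1%g, cone_time M k) @[M --> within join (nbhs x)] -->
      (to (classify k x) g^-1%g, cone_time x k).
    have c1 : to (classify k M) g^-1%g @[M --> within join (nbhs x)] -->
        to (classify k x) g^-1%g.
      by apply: (@cvg_comp _ _ _ (classify k) (fun y => to y g^-1%g) _ _ _ (IH bk));
        exact: act_cont.
    have c2 : cone_time M k @[M --> within join (nbhs x)] --> cone_time x k.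
      apply: (cvg_minr FF); first exact: cvg_cst.
      apply: cvgM; first by apply: cvgM => //; exact: cvg_cst.
      by apply: cvgV => //; rewrite gt_eqF.
    exact: (@cvg_pair _ _ _ _ (nbhs (to (classify k x) g^-1%g)) (nbhs (cone_time x k))
      FF _ _ _ _ c1 c2).
  have nj : \forall M \near within join (nbhs x), join M by exact: withinT.
  have := pair_cvg _ nW; rewrite /= nbhs_simpl /=.
  by apply: filterS2 nj => M jM; apply; exact: Bin.
move=> W /= nW.
(* Here the letter may jump near [x], but at [x] the time is 0, so each of the finitely many letters
   gives the same limit. *)
have [wk|wk] := eqVneq (weight x k) 0.
  have QE g : Q g x = classify k.+1 x by rewrite /= /Q cone_time0 // !H0 !total_actKV.
  have : \forall M \near within join (nbhs x), forall g, W (Q g M).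
    by apply: filter_forall => g; apply: Qcvg; rewrite QE.
  by apply: filterS => M /(_ (letter M k)).
have {}wk : 0 < weight x k by rewrite lt0r wk weight_ge0.
have := Qcvg (letter x k) _ nW; have := letter_near jx wk.
by apply: filterS2 => M; rewrite /Q /= => <-.
Unshelve. all: by end_near. Qed.

End ToContractible.
End Join.

(** * Lipschitz approximation on the join *)

Section CompactDomain.
Variables (R : realType) (V : normedModType R) (D : set V).
Hypothesis D_compact : compact D.

Lemma compact_unif_continuous (W : pseudoMetricNormedZmodType R) (f : V -> W) (e : R) :
  {within D, continuous f} -> 0 < e ->
  exists2 d : R, 0 < d & forall x y, D x -> D y -> `|x - y| < d -> `|f x - f y| < e.
Proof.
move=> /subspace_continuousP fc e0.
pose P (d : R) x := forall y, D x -> D y -> `|x - y| < d -> `|f x - f y| < e.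
have : \forall d \near 0^'+, D `<=` P d.
  move/compact_near_coveringP : D_compact; apply => x Dx.
  have e2 : 0 < e / 2 by lra.
  have FF : Filter (within D (nbhs x)) by exact: within_filter.
  have := @cvgr_dist_lt R W V (within D (nbhs x)) FF f (f x) (fc x Dx) _ e2.
  rewrite /within /= => /nbhs_ballP [r /= r0 rP].
  have r2 : 0 < r / 2 by lra.
  exists (ball x (r / 2), [set d : R | d < r / 2]) => /=.
    split; first exact: nbhsx_ballx.
    by apply: nbhs_right_lt.
  move=> [y d] /= [xy dr] z Dy Dz yz.
  rewrite -ball_normE /= in xy.
  have b1 : `|f x - f y| < e / 2 by apply: rP => //; rewrite -ball_normE /=; lra.
  have b2 : `|f x - f z| < e / 2.
    apply: rP => //; rewrite -ball_normE /=.
    by have := ler_distD y x z; lra.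
  have := ler_distD (f x) (f y) (f z); rewrite [`|f y - f x|]distrC; lra.
move=> [r /= r0 rP]; exists (r / 2); first by lra.
move=> x y Dx Dy xy; have rD : D `<=` P (r / 2).
  by apply: rP => /=; [rewrite sub0r normrN gtr0_norm; lra | lra].
exact: (rD x Dx y Dx Dy xy).
Qed.

Hypothesis D_neq0 : D !=set0.

Lemma compact_real_bound (f : V -> R) : {within D, continuous f} ->
  exists B : R, forall x, D x -> `|f x| <= B.
Proof.
move=> fc; have [c _ cP] := compact_EVT_max D_neq0 D_compact fc.
have [b _ bP] := compact_EVT_min D_neq0 D_compact fc.
exists (Num.max (f c) (- f b)) => x Dx; rewrite ler_norml lerNl !le_max.
by rewrite lerN2 bP ?inE // cP ?inE ?orbT.
Qed.

(** The Pasch-Hausdorff envelope: an infimum of L-Lipschitz functions of [x], hence L-Lipschitz on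
    the whole space. *)
Definition inf_conv (L : R) (f : V -> R) x := inf [set f z + L * `|x - z| | z in D].

Lemma inf_conv_le L f (B : R) x z : 0 <= L -> (forall y, D y -> `|f y| <= B) -> D z ->
  inf_conv L f x <= f z + L * `|x - z|.
Proof.
move=> L0 fB Dz; apply: ge_inf; last by exists z.
exists (- B) => _ [y Dy <-]; have := fB y Dy; rewrite ler_norml => /andP [le _].
by apply: le_trans le _; rewrite lerDl mulr_ge0.
Qed.

Lemma inf_conv_ge L f x (b : R) : (forall z, D z -> b <= f z + L * `|x - z|) ->
  b <= inf_conv L f x.
Proof.
move=> H; apply: lb_le_inf => [|_ [z Dz <-]]; last exact: H.
by have [z Dz] := D_neq0; exists (f z + L * `|x - z|), z.
Qed.

Lemma inf_conv_lipschitz L f (B : R) x y : 0 <= L -> (forall z, D z -> `|f z| <= B) ->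
  `|inf_conv L f x - inf_conv L f y| <= L * `|x - y|.
Proof.
move=> L0 fB; wlog le : x y / inf_conv L f y <= inf_conv L f x.
  move=> H; have /orP [le|le] := le_total (inf_conv L f y) (inf_conv L f x).
    exact: H.
  by rewrite distrC [`|x - y|]distrC; apply: H.
rewrite ger0_norm ?subr_ge0 // lerBlDr -lerBlDl; apply: inf_conv_ge => z Dz.
rewrite lerBlDl; apply: le_trans (inf_conv_le x L0 fB Dz) _.
by rewrite addrCA lerD2l -mulrDr ler_wpM2l // ler_distD.
Qed.

Lemma inf_conv_approx (f : V -> R) (e : R) : {within D, continuous f} -> 0 < e ->
  exists2 L : R, 0 <= L & forall x, D x -> `|inf_conv L f x - f x| <= e.
Proof.
move=> fc e0; have [B fB] := compact_real_bound fc.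
have [d d0 fd] := compact_unif_continuous fc e0.
have B0 : 0 <= B by have [z Dz] := D_neq0; apply: le_trans (fB z Dz).
(* With this slope a point at distance at least [d] costs 2 B, which covers the whole variation of
   [f]; closer points change [f] by less than [e]. *)
have L0 : 0 <= 2 * B / d by rewrite divr_ge0 ?mulr_ge0 // ltW.
exists (2 * B / d) => // x Dx; rewrite ler_distl; apply/andP; split; last first.
  have := inf_conv_le x L0 fB Dx; rewrite subrr normr0 mulr0 addr0 => /le_trans; apply.
  by rewrite lerDl ltW.
apply: inf_conv_ge => z Dz; have [xz|xz] := ltP `|x - z| d.
  have := fd x z Dx Dz xz; rewrite ltr_norml => /andP [_ lt].
  have : 0 <= 2 * B / d * `|x - z| by rewrite mulr_ge0.
  by lra.
have : 2 * B <= 2 * B / d * `|x - z|.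
  by rewrite mulrAC ler_pdivlMr // ler_wpM2l // mulr_ge0.
have := fB x Dx; have := fB z Dz; rewrite !ler_norml => /andP [? ?] /andP [? ?]; lra.
Qed.

End CompactDomain.

(** * Compactness of the join and counting its grid cells *)

Section JoinSpace.
Variables (R : realType) (gT : finGroupType) (N : nat).
Local Notation nG := #|[set: gT]%G|.
Local Notation space := 'M[R]_(N.+1, nG).
Local Notation join := (@join R gT N).
Implicit Types (M x : space).

Lemma mx_norm_le m n (x : 'M[R]_(m, n)) e : 0 <= e ->
  (forall i j, `|x i j| <= e) -> `|x| <= e.
Proof.
move=> e0 H; rewrite [leLHS]/Num.norm /= mx_normrE; by apply/bigmax_leP; split.
Qed.

Lemma le_mx_norm m n (x : 'M[R]_(m, n)) i j : `|x i j| <= `|x|.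
Proof.
rewrite [leRHS]/Num.norm /= mx_normrE; apply/bigmax_geP; right.
by exists (i, j).
Qed.

Definition vertex k : space := delta_mx (inord k) (idx 1%g).

Lemma entry_le1 M i j : join M -> M i j <= 1.
Proof.
case=> M0 <- _; rewrite (bigD1 i) //= (bigD1 j) //= -addrA lerDl.
by rewrite addr_ge0 ?sumr_ge0 // => k _; rewrite sumr_ge0.
Qed.

Lemma joinN0 : join !=set0.
Proof.
exists (vertex 0); split=> [i j||i j j']; rewrite ?mxE ?ler0n //.
  rewrite (bigD1 (inord 0)) //= (bigD1 (idx 1%g)) //= mxE !eqxx !big1 ?addr0 //.
    by move=> i /negPf ni; rewrite big1 // => j _; rewrite mxE ni.
  by move=> j /negPf nj; rewrite mxE nj andbF.
by rewrite !pnatr_eq0 !eqb0 !negbK => /andP [_ /eqP ->] /andP [_ /eqP ->].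
Qed.

Lemma join_closed : closed join.
Proof.
have cont (i : 'I_N.+1) (j : 'I_nG) : continuous (fun M : space => M i j).
  by move=> M; exact: coord_continuous.
have closed_pre (f : space -> R) E : continuous f -> closed E -> closed (f @^-1` E).
  by move=> fc; apply: preimage_closed => M _; exact: fc.
(* Having one nonzero entry per row becomes a closed condition: products of distinct entries of a
   row vanish. *)
have -> : join =
    (\bigcap_(ij in [set: 'I_N.+1 * 'I_nG]) [set M | 0 <= M ij.1 ij.2])
    `&` [set M | \sum_i \sum_j M i j = 1]
    `&` \bigcap_(t in [set t : 'I_N.+1 * 'I_nG * 'I_nG | t.1.2 != t.2])
      [set M | M t.1.1 t.1.2 * M t.1.1 t.2 = 0].
  apply/seteqP; split=> M /=.
    case=> M0 M1 Mu; split; [split=> // -[i j] _; exact: M0 | move=> [[i j] j'] /= jj'].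
    apply/eqP; rewrite mulf_eq0; apply: contraT; rewrite negb_or => /andP [n1 n2].
    by move: jj'; rewrite (Mu i j j') ?eqxx.
  case=> -[M0 M1] Mu; split=> // [i j|i j j' n1 n2]; first exact: (M0 (i, j)).
  apply/eqP; apply: contraT => jj'; have /= /eqP := Mu (i, j, j') jj'.
  by rewrite mulf_eq0 (negPf n1) (negPf n2).
apply: closedI; [apply: closedI|]; [apply: closed_bigI => -[i j] _ | | apply: closed_bigI => -[[i j] j'] _] => /=.
- exact: (closed_pre _ _ (cont i j) (@closed_ge R 0)).
- apply: (closed_pre (fun M : space => \sum_i \sum_j M i j) _ _ (@closed_eq R 1)) => M.
  apply: (cvg_sumr (nbhs_filter M)) => i.
  by apply: (cvg_sumr (nbhs_filter M)) => j; exact: (cont i j M).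
apply: (closed_pre (fun M : space => M i j * M i j') _ _ (@closed_eq R 0)) => M.
exact: cvgM (cont i j M) (cont i j' M).
Qed.

Lemma join_compact : compact join.
Proof.
pose cube := [set v : 'rV[R]_(N.+1 * nG) | forall i, `[0, 1]%classic (v ord0 i)].
have cc : compact (vec_mx @` cube : set space).
  apply: continuous_compact.
    apply: continuous_subspaceT => v; apply: (cvg_mx (nbhs_filter v)) => i j.
    under eq_fun do rewrite mxE; rewrite mxE.
    exact: (@coord_continuous R 1 _ ord0 (mxvec_index i j) v).
  by apply: (@rV_compact R _ (fun=> `[0, 1]%classic)) => _; exact: segment_compact.
apply: subclosed_compact join_closed cc _ => M jM; exists (mxvec M).
  move=> k /=; case/mxvec_indexP: k => i j; rewrite mxvecE in_itv /=.
  by rewrite entry_le1 // andbT; case: jM.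
exact: mxvecK.
Qed.

Lemma act_norm M g : `|regular_act M g| = `|M|.
Proof.
suff le h (x : space) : `|regular_act x h| <= `|x|.
  apply/eqP; rewrite eq_le le /=.
  rewrite -{1}(regular_actK M g).
  exact: le.
apply: mx_norm_le => // i j; have [h' ->] := idx_onto j.
by rewrite regular_actE; exact: le_mx_norm.
Qed.

Lemma entry_letter M k g : join M ->
  M (inord k) (idx g) = if g == letter M k then weight M k else 0.
Proof.
move=> jM; have [e|n0] := eqVneq (M (inord k) (idx g)) 0.
  case: eqP => // gl; rewrite e; apply/eqP; rewrite eq_sym; apply: contraT => w0.
  have : 0 < weight M k by rewrite lt0r w0 weight_ge0.
  by move/letterP; rewrite -gl e eqxx.
rewrite (letter_eq jM n0) eqxx /weight (bigD1 (idx g)) //= big1 ?addr0 // => j nj.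
have [_ _ Mu] := jM; apply/eqP; apply: contraT => Mj.
by move: nj; rewrite (Mu _ _ _ n0 Mj) eqxx.
Qed.

Lemma weight_le1 M k : join M -> weight M k <= 1.
Proof.
move=> jM; rewrite /weight sum_idx (bigD1 (letter M k)) //= big1 ?addr0.
  exact: entry_le1.
by move=> g ng; rewrite entry_letter // (negPf ng).
Qed.

(** The last weight is omitted, being 1 minus the others; hence the number of keys is of order q^N
    and not q^(N+1). *)
Definition grid_key q M : {ffun 'I_N.+1 -> gT} * {ffun 'I_N -> 'I_q.+1} :=
  ([ffun k : 'I_N.+1 => letter M k],
   [ffun k : 'I_N => inord (Num.truncn (q%:R * weight M k))]).

Lemma grid_key_close q M x : (0 < q)%N -> join M -> join x ->
  grid_key q M = grid_key q x -> `|M - x| <= N.+1%:R / q%:R.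
Proof.
move=> q0 jM jx [/ffunP el /ffunP ek].
have q0R : 0 < q%:R :> R by rewrite ltr0n.
have small k : (k < N)%N -> `|weight M k - weight x k| <= 1 / q%:R.
  move=> kN; have := ek (Ordinal kN); rewrite !ffunE /=.
  have bound y : join y -> (Num.truncn (q%:R * weight y k) < q.+1)%N.
    move=> jy; rewrite ltnS -(ler_nat R).
    have y0 : 0 <= q%:R * weight y k by rewrite mulr_ge0 ?weight_ge0 ?ler0n.
    apply: le_trans (_ : q%:R * weight y k <= _); first by have /andP [] := truncn_itv y0.
    by rewrite ler_piMr ?ler0n ?weight_le1.
  move/(congr1 val); rewrite /= !inordK ?bound // => e.
  have itv y : join y -> (Num.truncn (q%:R * weight y k))%:R <= q%:R * weight y k <
      (Num.truncn (q%:R * weight y k)).+1%:R.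
    by move=> jy; apply: truncn_itv; rewrite mulr_ge0 ?weight_ge0 ?ler0n.
  have := itv M jM; have := itv x jx; rewrite -e.
  rewrite ler_pdivlMr // -(gtr0_norm q0R) -normrM gtr0_norm // mulrBl.
  rewrite ![_ * q%:R]mulrC -natr1 => /andP [? ?] /andP [? ?].
  by rewrite ler_norml; apply/andP; split; lra.
have small_w k : (k < N.+1)%N -> `|weight M k - weight x k| <= N.+1%:R / q%:R.
  (* The error in the last weight is at most the sum of the N other errors. *)
  rewrite ltnS leq_eqVlt => /predU1P [->|kN]; last first.
    apply: le_trans (small k kN) _; rewrite ler_wpM2r ?invr_ge0 ?ler0n //.
    by rewrite ler1n.
  have top y : join y -> weight y N = 1 - weight_below y N.
    by move=> /weight_below_top; rewrite weight_belowS => <-; rewrite addrC addKr.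
  have subB (a b : R) : 1 - a - (1 - b) = b - a by ring.
  rewrite !top // subB distrC -sumrB.
  apply: le_trans (ler_norm_sum _ _ _) _.
  apply: le_trans (_ : \sum_(i < N) 1 / q%:R <= _).
    by apply: ler_sum => i _; exact: small.
  rewrite sumr_const card_ord -[_ *+ N]mulr_natl mulrA mulr1.
  by rewrite ler_wpM2r ?invr_ge0 ?ler0n // ler_nat.
apply: mx_norm_le => [|i j]; first by rewrite divr_ge0 ?ler0n.
have [g ->] := idx_onto j; rewrite !mxE -[i]inord_val !entry_letter //.
have := el i; rewrite !ffunE => ->; case: ifP => _; first exact: small_w.
by rewrite subrr normr0 divr_ge0 ?ler0n.
Qed.

(* Pigeonhole: [join] meets only O(q^N) grid cells of size 1/q, too few for a
   Lipschitz map to hit all of a grid of q^n points. *)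
Lemma lipschitz_misses n (L : space -> 'rV[R]_n) (l c : R) : (N < n)%N -> 0 < c ->
  0 <= l -> (forall M x j, join M -> join x -> `|L M 0 j - L x 0 j| <= l * `|M - x|) ->
  exists2 z : 'rV[R]_n, forall j, `|z 0 j| <= c & forall M, join M -> L M != z.
Proof.
move=> Nn c0 l0 Llip; apply: contrapT => hit.
(* As C > l (N+1) / c, two points of one cell of size 1/q, q = C m, have images closer than the mesh
   c / m. The choice of [m] makes the number of keys, at most P (C+1)^N m^N, smaller than m^(N+1),
   hence than the m^n grid points. *)
pose C := (Num.truncn (l * N.+1%:R / c)).+1.
pose P := (#|gT| ^ N.+1)%N.
pose m := (P * C.+1 ^ N).+1; pose q := (C * m)%N.
have m0 : 0 < m%:R :> R by rewrite ltr0n.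
have c0' := ltW c0; have m0' := ltW m0.
pose pt (a : {ffun 'I_n -> 'I_m}) : 'rV[R]_n := \row_j (c * (a j : nat)%:R / m%:R).
have ptc a j : `|pt a 0 j| <= c.
  rewrite mxE ger0_norm ?divr_ge0 ?mulr_ge0 ?ler0n //.
  by rewrite ler_pdivrMr // ler_wpM2l // ler_nat ltnW.
have hitP a : {M | join M & L M = pt a}.
  apply: cid2; apply: contrapT => nM; apply: hit; exists (pt a) => // M jM.
  by apply/eqP => LM; apply: nM; exists M.
pose key a := grid_key q (s2val (hitP a)).
have /negP [] : ~~ injectiveb key.
  apply/negP => /injectiveP /leq_card; apply/negP.
  rewrite -ltnNge card_prod !card_ffun !card_ord.
  apply: (@leq_ltn_trans (P * (C.+1 ^ N * m ^ N))).
    rewrite leq_mul // -expnMn.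
    have mono a b : (a <= b)%N -> (a ^ N <= b ^ N)%N.
      by move=> ab; elim: (N) => // k IH; rewrite !expnS leq_mul.
    by apply: mono; rewrite mulSn addnC -addn1 leq_add2l.
  rewrite mulnA; apply: (@leq_trans (m * m ^ N)).
    by rewrite ltn_pmul2r ?expn_gt0.
  by rewrite -expnS leq_pexp2l.
apply/injectiveP => a b ab; apply/ffunP => j; apply/val_inj/eqP.
have q0 : (0 < q)%N by rewrite muln_gt0.
have := grid_key_close q0 _ _ ab; case: (hitP a) (hitP b) => Ma ja La [Mb jb Lb] /=.
move=> /(_ ja jb) close; have := Llip Ma Mb j ja jb; rewrite La Lb !mxE -mulrBl -mulrBr.
rewrite !normrM normfV (gtr0_norm c0) (gtr0_norm m0) => le.
apply: contraT => abj.
have le1 : 1 <= `|(a j : nat)%:R - (b j : nat)%:R : R|.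
  move: abj; rewrite neq_ltn => /orP [lt|lt]; [rewrite distrC|];
    by apply: le_trans (ler_norm _); rewrite lerBrDl natr1 ler_nat.
have C00 : 0 <= l * N.+1%:R / c by rewrite ?divr_ge0 ?mulr_ge0 ?ler0n.
have /andP [_ C0] := truncn_itv C00; rewrite -/C in C0.
have : c / m%:R <= l * (N.+1%:R / q%:R).
  apply: le_trans (_ : c * `|(a j : nat)%:R - (b j : nat)%:R| / m%:R <= _).
    by rewrite ler_wpM2r ?invr_ge0 // ler_peMr.
  by apply: le_trans le _; rewrite ler_wpM2l.
rewrite /q natrM invfM !mulrA ler_pM2r ?invr_gt0 // leNgt => /negP [].
by rewrite ltr_pdivrMr ?ltr0n // [c * _]mulrC -ltr_pdivrMr.
Qed.

Lemma regular_actB M x g : regular_act M g - regular_act x g = regular_act (M - x) g.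
Proof. by rewrite /regular_act mulmxBl. Qed.

(** The action permutes columns, so it preserves the sup norm and the join; the infimum may be
    reindexed by it. *)
Lemma inf_conv_act l (f : space -> R) (B : R) M g : 0 <= l ->
  (forall x, join x -> `|f x| <= B) ->
  (forall x h, join x -> f (regular_act x h) = f x) ->
  inf_conv join l f (regular_act M g) = inf_conv join l f M.
Proof.
move=> l0 fB finv.
have le x h : inf_conv join l f (regular_act x h) <= inf_conv join l f x.
  apply: (inf_conv_ge joinN0) => z jz; rewrite -(finv z h jz) -(act_norm _ h) -regular_actB.
  by apply: inf_conv_le fB _ => //; exact: join_act.
have := le (regular_act M g) g^-1%g; rewrite regular_actK => ge.
apply: le_anti; apply/andP; split; [exact: le | exact: ge].
Qed.

Lemma approx_missing n (f : space -> 'rV[R]_n) (c : R) : (N < n)%N -> 0 < c ->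
  {within join, continuous f} ->
  (forall M g, join M -> f (regular_act M g) = f M) ->
  exists L : space -> 'rV[R]_n, exists z : 'rV[R]_n,
    [/\ {within join, continuous L},
        forall M g, join M -> L (regular_act M g) = L M,
        forall M j, join M -> `|L M 0 j - f M 0 j| <= c,
        forall j, `|z 0 j| <= c & forall M, join M -> L M != z].
Proof.
move=> Nn c0 fc finv.
have fjc j : {within join, continuous (fun M => f M 0 j)}.
  move=> M; apply: (@continuous_comp (subspace join) _ _ f (fun v : 'rV[R]_n => v 0 j)).
    exact: fc.
  exact: coord_continuous.
have /choice [l lP] : forall j, exists l : R, 0 <= l /\ forall M, join M ->
    `|inf_conv join l (fun M => f M 0 j) M - f M 0 j| <= c.
  by move=> j; have [l] := inf_conv_approx join_compact joinN0 (fjc j) c0; exists l.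
have /choice [B fB] : forall j, exists B, forall M, join M -> `|f M 0 j| <= B.
  by move=> j; exact: (compact_real_bound join_compact joinN0 (fjc j)).
have [L LE] : {L : space -> 'rV[R]_n | forall M j,
    L M 0 j = inf_conv join (l j) (fun x => f x 0 j) M}.
  by exists (fun M => \row_j inf_conv join (l j) (fun x => f x 0 j) M) => M j; rewrite mxE.
pose s := \sum_j l j.
have s0 : 0 <= s by apply: sumr_ge0 => j _; case: (lP j).
have Llip M x j : `|L M 0 j - L x 0 j| <= s * `|M - x|.
  rewrite !LE; apply: le_trans (inf_conv_lipschitz joinN0 _ _ (lP j).1 (fB j)) _.
  rewrite ler_wpM2r // /s (bigD1 j) //= lerDl.
  by apply: sumr_ge0 => k _; case: (lP k).
have [z zc zL] := @lipschitz_misses n L s c Nn c0 s0 (fun M x j _ _ => Llip M x j).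
exists L, z; split.
- apply: continuous_subspaceT => M; apply: (cvg_mx (nbhs_filter M)) => i j.
  rewrite [i]ord1; apply/cvgrPdist_lt => e e0.
  have s1 : 0 < s + 1 by lra.
  apply/nbhs_ballP; exists (e / (s + 1)) => /=; first by rewrite divr_gt0.
  move=> x; rewrite -ball_normE /= ltr_pdivlMr // => lt.
  apply: le_lt_trans (Llip M x j) _; apply: le_lt_trans lt.
  by rewrite mulrC ler_wpM2l // lerDl.
- move=> M g jM; apply/rowP => j; rewrite !LE.
  by apply: inf_conv_act (lP j).1 (fB j) _ => x h jx; rewrite finv.
- by move=> M j jM; rewrite LE; exact: (lP j).2.
- exact: zc.
exact: zL.
Qed.

End JoinSpace.

(** * Pushing a map off the high-dimensional cells *)

Lemma closed_within (X Y : topologicalType) (D E : set X) (f : X -> Y) (A : set Y) (B : set Y) :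
  closed (D : set (subspace E)) ->
  {within E, continuous f} -> closed (A : set (subspace B)) ->
  (forall x, D x -> E x -> B (f x)) ->
  closed (D `&` f @^-1` A : set (subspace E)).
Proof.
move=> cD fc /closed_subspaceP [W cW WB] DB.
have cWE : closed (f @^-1` W : set (subspace E)).
  by move/continuous_closedP : fc => /(_ _ cW).
have /closed_subspaceP [Z cZ ZE] := closedI cD cWE.
apply/closed_subspaceP; exists Z => //; rewrite ZE; apply/seteqP.
split=> x /= [[Dx fx] Ex]; split=> //; split=> //.
  have : (W `&` B) (f x) by split=> //; exact: DB.
  by rewrite WB => -[].
have : (A `&` B) (f x) by split=> //; exact: DB.
by rewrite -WB => -[].
Qed.

Lemma closed_subspace_ext (X : topologicalType) (B A A' : set X) :
  (forall x, B x -> A x <-> A' x) -> closed (A' : set (subspace B)) ->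
  closed (A : set (subspace B)).
Proof.
move=> E /closed_subspaceP [V cV VA]; apply/closed_subspaceP; exists V => //.
by rewrite VA; apply/seteqP; split=> x [Ax Bx]; split=> //; apply/(E x Bx).
Qed.

Section Cells.
Variables (R : realType) (gT : finGroupType) (X : topologicalType).
Variables (to : {action gT &-> X}) (K : GCW R to).
Hypothesis to_free : free_action to.
Local Notation below := (skeleton_below (skel K)).

Lemma isotropy_trivial n (i : cell K n) : isotropy i = 1%G.
Proof.
apply/trivGP/fintype.subsetP => h hi; rewrite inE; apply/eqP.
apply: (to_free (x := chi i 0)); apply: chi_isotropy hi.
by rewrite /disk /= big1 ?ler01 // => j _; rewrite mxE expr0n.
Qed.

Lemma interior_disk n : disk_interior R n `<=` disk R n.
Proof. by move=> y /ltW. Qed.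

Lemma disk_cases n y : disk R n y -> disk_boundary R n y \/ disk_interior R n y.
Proof.
by rewrite /disk /disk_boundary /disk_interior /= le_eqVlt => /orP [/eqP|]; [left|right].
Qed.

Lemma below_act n x g : below n x -> below n (to x g).
Proof. by case: n => //= n; exact: skel_act. Qed.

Lemma skel_le m n : (m <= n)%N -> skel K m `<=` skel K n.
Proof.
move=> /subnK <-; elim: (n - m)%N => // k IH x /IH; exact: skel_subset.
Qed.

Definition in_cell n (c : cell K n * gT * 'rV[R]_n) x :=
  disk_interior R n c.2 /\ x = to (chi c.1.1 c.2) c.1.2.

Lemma in_cell_uniq n c c' x : in_cell (n := n) c x -> in_cell c' x -> c = c'.
Proof.
case: c c' => [[i g] y] [[j h] z] [/= Dy xy] [/= Dz xz].
have := chi_injective Dy Dz (etrans (esym xy) xz) => -[ij -> e]; subst j.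
congr (_, _, _); move: e; rewrite isotropy_trivial !mul1g => /setP /(_ g).
by rewrite !inE eqxx => /esym /eqP.
Qed.

Lemma in_cell_not_below n c x : in_cell (n := n) c x -> ~ below n x.
Proof.
case: c => [[i g] y] [/= Dy ->] /(below_act g^-1%g).
by rewrite total_actK; exact: chi_interior.
Qed.

Lemma in_cell_act n i g y x h :
  in_cell (n := n) (i, g, y) x -> in_cell (i, g * h, y)%g (to x h).
Proof. by case=> /= Dy ->; split => //=; rewrite total_actM. Qed.

(** For a free action these coordinates are unique. [None] is the value at every point outside the
    open n-cells. *)
Definition coord n x : option (cell K n * gT * 'rV[R]_n) :=
  if pselect (exists c, in_cell c x) is left e then Some (projT1 (cid e)) else None.

Lemma coord_Some n c x : in_cell c x -> coord n x = Some c.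
Proof.
move=> cx; rewrite /coord; case: pselect => [e|[]]; last by exists c.
by case: cid => c' /= c'x; rewrite (in_cell_uniq cx c'x).
Qed.

Lemma coord_cell n c x : coord n x = Some c -> in_cell c x.
Proof. by rewrite /coord; case: pselect => // e; case: cid => c' /= ? [<-]. Qed.

Lemma coord_below n x : below n x -> coord n x = None.
Proof.
move=> bx; case e : coord => [c|] //; case: (in_cell_not_below (coord_cell e) bx).
Qed.

Lemma coord_None n x : skel K n x -> coord n x = None -> below n x.
Proof.
move=> sx e; apply: contrapT => bx.
have [i [y [g [Dy xy]]]] := chi_surjective sx bx.
by have := coord_Some (c := (i, g, y)) (conj Dy xy); rewrite e.
Qed.

Lemma coord_act n x h : coord n (to x h) =
  if coord n x is Some (i, g, y) then Some (i, (g * h)%g, y) else None.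
Proof.
case e : (coord n x) => [[[i g] y]|].
  by apply: coord_Some; apply: in_cell_act; exact: coord_cell.
case e' : coord => [[[i g] y]|] //; have := in_cell_act h^-1%g (coord_cell e').
by rewrite total_actK => /coord_Some; rewrite e.
Qed.

(** Gluing along the pushout: data on the open n-cells together with a map on the lower skeleton. *)
Definition cellwise n (Z : Type) (phi : cell K n -> gT -> 'rV[R]_n -> Z) (d : X -> Z) x :=
  if coord n x is Some (i, g, y) then phi i g y else d x.

Lemma cellwise_chi n (Z : Type) (phi : cell K n -> gT -> 'rV[R]_n -> Z) d i g y :
  (forall i g y, disk_boundary R n y -> d (to (chi i y) g) = phi i g y) ->
  disk R n y -> cellwise phi d (to (chi i y) g) = phi i g y.
Proof.
move=> E Dy; case: (disk_cases Dy) => [By|Iy].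
  rewrite /cellwise coord_below ?E //; apply: below_act; exact: chi_boundary.
by rewrite /cellwise (coord_Some (c := (i, g, y))).
Qed.

Lemma cellwise_continuous n (Z : topologicalType)
    (phi : cell K n -> gT -> 'rV[R]_n -> Z) d :
  {within below n, continuous d} ->
  (forall i g, {within disk R n, continuous (phi i g)}) ->
  (forall i g y, disk_boundary R n y -> d (to (chi i y) g) = phi i g y) ->
  {within skel K n, continuous (cellwise phi d)}.
Proof.
move=> dc pc E; apply/continuous_closedP => W cW; apply: chi_final => [|i g].
  apply: (@closed_subspace_ext _ _ _ (d @^-1` W)) => [x bx|].
    by rewrite /= /from_subspace /cellwise coord_below.
  by move/continuous_closedP : dc => /(_ _ cW).
apply: (@closed_subspace_ext _ _ _ (phi i g @^-1` W)) => [y Dy|].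
  by rewrite /= /from_subspace cellwise_chi.
by have /continuous_closedP/(_ _ cW) := pc i g.
Qed.

Definition sqnorm n (y : 'rV[R]_n) : R := \sum_i y 0 i ^+ 2.

Lemma sqnorm_continuous n : continuous (@sqnorm n).
Proof.
move=> y; apply: (cvg_sumr (nbhs_filter y)) => i.
have c := @coord_continuous R 1 n 0 i y.
exact: (cvgM c c).
Qed.

Lemma act_chi_continuous n (i : cell K n) g :
  {within disk R n, continuous (fun y => to (chi i y) g)}.
Proof.
move=> y; apply: (@continuous_comp _ _ _ (chi i : subspace _ -> X) (fun x => to x g)).
  exact: chi_continuous.
exact: (act_continuous K).
Qed.

(** Induction over the pushouts: in a closed disk, the preimage of [A] is a boundary part, closed by
    induction, and a finite interior part. *)
Lemma below_closed_of_finite (A : set X) n :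
  (forall m, (m < n)%N -> finite_set (A `&` (skel K m `\` below m))) ->
  closed (A : set (subspace (below n))).
Proof.
elim: n => [|n IH] fA.
  by apply/closed_subspaceP; exists set0; [exact: closed0 | rewrite /= !setI0].
have bA : closed (A : set (subspace (below n))).
  by apply: IH => m mn; apply: fA; rewrite ltnS ltnW.
apply: chi_final => // i g.
pose A' := (disk_boundary R n `&` (fun y => to (chi i y) g) @^-1` A) `|`
  (disk_interior R n `&` (fun y => to (chi i y) g) @^-1` A).
apply: (@closed_subspace_ext _ _ _ A') => [y Dy|].
  split=> [Ay|[[]|[]] //]; by case: (disk_cases Dy) => Hy; [left|right].
apply: closedU.
  apply: closed_within (@act_chi_continuous n i g) bA _; last first.
    by move=> y By _; apply: below_act; exact: chi_boundary.
  apply: closed_subspaceW; apply: (@preimage_closed _ _ (@sqnorm n) [set r | r = 1]).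
    by move=> y _; exact: sqnorm_continuous.
  exact: closed_eq.
apply: closed_subspaceW; apply: (accessible_finite_set_closed.1 _).
  exact: hausdorff_accessible (@norm_hausdorff _ _).
pose pos x := if coord n x is Some c then c.2 else 0.
apply: sub_finite_set (finite_image pos (fA n (ltnSn n))) => y [Iy Ay].
have cy : in_cell (i, g, y) (to (chi i y) g) by [].
exists (to (chi i y) g); last by rewrite /pos (coord_Some cy).
split=> //; split; last exact: in_cell_not_below cy.
by apply: skel_act; apply: chi_disk; exact: interior_disk.
Qed.

Lemma closed_of_finite (A : set X) :
  (forall n, finite_set (A `&` (skel K n `\` below n))) -> closed A.
Proof.
move=> fA; apply: (skel_colimit (g0 := K)) => n.
exact: (@below_closed_of_finite A n.+1 (fun m _ => fA m)).
Qed.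

(** Otherwise choose [u n] with image outside the n-skeleton. Each skeleton contains finitely many
    of the images, so a tail of them is a closed set; it can be taken to miss the image of a cluster
    point of [u], contradicting continuity. *)
Lemma compact_image_skel (T : topologicalType) (C : set T) (f : T -> X) :
  compact C -> {within C, continuous f} -> exists n, forall x, C x -> skel K n (f x).
Proof.
move=> cC fc; apply: contrapT => unbounded.
have /choice [u uP] : forall n, exists x, C x /\ ~ skel K n (f x).
  move=> n; apply: contrapT => nx; apply: unbounded; exists n => x Cx.
  by apply: contrapT => fx; apply: nx; exists x.
have [z [Cz /= clz]] := cC (u @ \oo) _ (filterS (fun n _ => (uP n).1) filterT).
have [q _ fzq] : (\bigcup_n skel K n) (f z) by rewrite skel_cover.
pose A := [set f (u n) | n in [set n | (q <= n)%N]].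
have cA : closed A.
  apply: closed_of_finite => n.
  apply: (@sub_finite_set _ _ [set f (u m) | m in `I_n]); last exact: finite_image.
  move=> _ [[m qm <-] [fm _]]; exists m => //=; rewrite ltnNge; apply/negP => nm.
  by apply: (uP m).2; apply: skel_le fm.
have nA : nbhs (f z) (~` A).
  apply: open_nbhs_nbhs; split; first exact: closed_openC.
  by move=> [m qm e]; apply: (uP m).2; rewrite e; exact: skel_le fzq.
have := (subspace_continuousP _ _).1 fc z Cz _ nA.
rewrite /= nbhs_simpl /= /within /= => nW.
have Fq : (u @ \oo) [set u n | n in [set n | (q <= n)%N]].
  by exists q => // n /= qn; exists n.
have [_ [[n qn <-] /= /(_ (uP n).1) []]] := clz _ _ Fq nW.
by exists n.
Qed.

End Cells.

Lemma within_comp (X Y Z : topologicalType) (A : set X) (B : set Y) (f : X -> Y)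
    (g : Y -> Z) x :
  A x -> (forall u, A u -> B (f u)) -> f @ within A (nbhs x) --> f x ->
  {within B, continuous g} -> g \o f @ within A (nbhs x) --> g (f x).
Proof.
move=> Ax AB fx gc W nW.
have gW : nbhs (f x) [set v | B v -> W (g v)].
  exact: ((subspace_continuousP _ _).1 gc _ (AB x Ax) W nW).
have : nbhs x [set u | A u -> B (f u) -> W (g (f u))] by exact: fx gW.
by move=> H; apply: filterS H => u H Au; apply: H => //; exact: AB.
Qed.

Lemma cvg_maxr (T : Type) (F : set_system T) (R : realType)
    (f g : T -> R) (a b : R) : Filter F ->
  f x @[x --> F] --> a -> g x @[x --> F] --> b ->
  Num.max (f x) (g x) @[x --> F] --> Num.max a b.
Proof.
move=> FF fa gb; apply: (@continuous2_cvg _ R R R _ _ f g Num.max) fa gb.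
exact: (@max_continuous _ R (a, b)).
Qed.

(** * Cutoffs and radial projection in the disk *)

Section Vectors.
Variables (R : realType) (n : nat).
Implicit Types (y u l z : 'rV[R]_n) (s : R).

Definition unit_vector u := (Num.sqrt (sqnorm u))^-1 *: u.
(** The argument is a squared norm. The inner cutoff is 1 up to 1/4 and 0 from 1/2 on, the outer one
    is 1 up to 3/4 and 0 from 1 on; so the outer is 1 wherever the inner is nonzero. *)
Definition inner_cutoff s : R := Num.max 0 (Num.min 1 (2 - 4 * s)).
Definition outer_cutoff s : R := Num.max 0 (Num.min 1 (4 - 4 * s)).

Lemma sqnorm_ge0 u : 0 <= sqnorm u.
Proof. by apply: sumr_ge0 => i _; rewrite sqr_ge0. Qed.

Lemma sqnormZ s u : sqnorm (s *: u) = s ^+ 2 * sqnorm u.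
Proof. by rewrite /sqnorm mulr_sumr; apply: eq_bigr => i _; rewrite mxE exprMn. Qed.

Lemma sqnorm_eq0 u : (sqnorm u == 0) = (u == 0).
Proof.
apply/eqP/eqP => [/eqP|->]; last by rewrite /sqnorm big1 // => i _; rewrite mxE expr0n.
rewrite psumr_eq0 => [/allP H|i _]; last by rewrite sqr_ge0.
apply/rowP => i; rewrite mxE; apply/eqP; rewrite -sqrf_eq0.
by apply: (implyP (H i _)) => //; rewrite mem_index_enum.
Qed.

Lemma sqnorm_unit u : u != 0 -> sqnorm (unit_vector u) = 1.
Proof.
move=> u0; rewrite sqnormZ exprVn sqr_sqrtr ?sqnorm_ge0 // mulVf //.
by rewrite sqnorm_eq0.
Qed.

Lemma disk_unit u : disk R n (unit_vector u).
Proof.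
have [->|u0] := eqVneq u 0; last by rewrite /disk /= -/(sqnorm _) sqnorm_unit.
by rewrite /disk /= -/(sqnorm _) sqnormZ (eqP (_ : sqnorm 0 == 0)) ?sqnorm_eq0 ?mulr0.
Qed.

Lemma cutoff_continuous (a : R) : continuous (fun s : R => Num.max 0 (Num.min 1 (a - 4 * s))).
Proof.
move=> s; apply: (cvg_maxr (nbhs_filter s)); first exact: cvg_cst.
apply: (cvg_minr (nbhs_filter s)); first exact: cvg_cst.
apply: cvgB; first exact: cvg_cst.
by apply: cvgMl_tmp; exact: cvg_id.
Qed.

Lemma sqrt_sqnorm_continuous : continuous (fun u => Num.sqrt (sqnorm u)).
Proof.
move=> u; apply: (@cvg_comp _ _ _ (@sqnorm R n) Num.sqrt _ (nbhs (sqnorm u))).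
  exact: sqnorm_continuous.
exact: sqrt_continuous.
Qed.

Lemma unit_vector_continuous u : u != 0 -> {for u, continuous unit_vector}.
Proof.
move=> u0; apply: (@cvgZ _ _ _ _ (nbhs_filter u)); last exact: cvg_id.
apply: (@cvgV _ _ _ (nbhs_filter u)); last exact: sqrt_sqnorm_continuous.
by rewrite sqrtr_eq0 -ltNge lt0r sqnorm_eq0 u0 sqnorm_ge0.
Qed.

Lemma clipped_scale_continuous :
  continuous (fun u => (Num.max (1 / 2) (Num.sqrt (sqnorm u)))^-1 *: u).
Proof.
move=> u; apply: (@cvgZ _ _ _ _ (nbhs_filter u)); last exact: cvg_id.
apply: (@cvgV _ _ _ (nbhs_filter u)).
  by rewrite gt_eqF // lt_max; apply/orP; left; lra.
apply: (cvg_maxr (nbhs_filter u)); first exact: cvg_cst.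
exact: sqrt_sqnorm_continuous.
Qed.

(* Where the inner cutoff is 1 the vector is [l - z]; elsewhere [y] is long and
   the correction is short. *)
Lemma pushed_neq0 (y l z : 'rV[R]_n) : sqnorm y < 1 ->
  (forall j, `|l 0 j - (outer_cutoff (sqnorm y) *: y) 0 j| <= (8 * n%:R)^-1) ->
  (forall j, `|z 0 j| <= (8 * n%:R)^-1) -> l != z ->
  y + inner_cutoff (sqnorm y) *: (l - outer_cutoff (sqnorm y) *: y - z) != 0.
Proof.
move=> y1 lb zb lz; set s := sqnorm y in y1 lb *.
have [s4|s4] := leP s (1 / 4).
  have -> : inner_cutoff s = 1 by rewrite /inner_cutoff min_l ?max_r //; lra.
  have -> : outer_cutoff s = 1 by rewrite /outer_cutoff min_l ?max_r //; lra.
  by rewrite !scale1r addrA [y + _]addrC subrK subr_eq0.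
apply/negP => /eqP /rowP u0.
set c := (8 * n%:R)^-1 in lb zb.
have c0 : 0 <= c by rewrite invr_ge0 mulr_ge0 ?ler0n.
have t01 : 0 <= inner_cutoff s <= 1.
  by rewrite /inner_cutoff le_max lexx /= ge_max ler01 /= ge_min lexx.
have yb j : y 0 j ^+ 2 <= (2 * c) ^+ 2.
  have := u0 j; rewrite !mxE => /eqP; rewrite addr_eq0 => /eqP ->.
  have := lb j; have := zb j; rewrite !mxE; set a := outer_cutoff s * y 0 j => zj lj.
  rewrite -[leLHS]real_normK ?num_real // lerXn2r ?nnegrE ?mulr_ge0 //.
  rewrite normrN normrM ger0_norm; last by case/andP: t01.
  have le2 : `|l 0 j - a - z 0 j| <= 2 * c.
    by apply: le_trans (ler_normB _ _) _; lra.
  apply: le_trans le2; rewrite ler_piMl //; first by case/andP: t01.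
have : s <= \sum_(j < n) (2 * c) ^+ 2 by apply: ler_sum => j _; exact: yb.
rewrite sumr_const card_ord -[_ *+ n]mulr_natl => le.
(* With c = 1/(8n), entries bounded by 2c give squared norm at most 1/16, against s > 1/4. *)
have : n%:R * (2 * c) ^+ 2 <= 1 / 16.
  have [->|n0] := posnP n; first by rewrite mul0r.
  have n1 : 1 <= n%:R :> R by rewrite ler1n.
  have -> : n%:R * (2 * c) ^+ 2 = (16 * n%:R)^-1 by rewrite /c; field; lra.
  by rewrite div1r lef_pV2 ?posrE; lra.
lra.
Qed.

End Vectors.

(** * Pushing an equivariant map off the open n-cells *)

Section Push.
Variables (R : realType) (gT : finGroupType) (X : topologicalType).
Variables (to : {action gT &-> X}) (K : GCW R to).
Hypothesis to_free : free_action to.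
Variables (N n : nat) (f : 'M[R]_(N.+1, #|[set: gT]%G|) -> X).
Local Notation join := (@join R gT N).
Local Notation below := (skeleton_below (skel K)).
Hypothesis f_cont : {within join, continuous f}.
Hypothesis f_skel : forall M, join M -> skel K n (f M).
Hypothesis f_act : forall M g, join M -> f (regular_act M g) = to (f M) g.

Definition radius : X -> R :=
  cellwise (fun (_ : cell K n) (_ : gT) y => sqnorm y) (fun=> 1).

(** The extension by 1 turns membership in a smaller ball of the cell [(i, g)] into an open
    condition on the skeleton. *)
Definition cell_radius i g : X -> R := cellwise
  (fun (j : cell K n) h y => if pselect (j = i /\ h = g) then sqnorm y else 1) (fun=> 1).

(** Ignoring the group element makes this invariant on the orbit of the cell; the cutoff lets it
    extend continuously by 0. *)
Definition position i : X -> 'rV[R]_n := cellwise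
  (fun (j : cell K n) (_ : gT) y =>
     if pselect (j = i) then outer_cutoff (sqnorm y) *: y else 0) (fun=> 0).

(** Projection to the cell boundary where the norm is at least 1/2; the clipping only keeps the
    formula continuous at the centre. *)
Definition radial : X -> X := cellwise
  (fun (i : cell K n) g y =>
     to (chi i ((Num.max (1 / 2) (Num.sqrt (sqnorm y)))^-1 *: y)) g) id.

Lemma radius_continuous : {within skel K n, continuous radius}.
Proof.
apply: (cellwise_continuous to_free) => [|i g|i g y By].
- by move=> x; exact: cvg_cst.
- exact: continuous_subspaceT (@sqnorm_continuous _ _).
- by rewrite /= -By.
Qed.

Lemma cell_radius_continuous i g : {within skel K n, continuous (cell_radius i g)}.
Proof.
apply: (cellwise_continuous to_free) => [|j h|j h y By].
- by move=> x; exact: cvg_cst.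
- case: pselect => ? /=; first exact: continuous_subspaceT (@sqnorm_continuous _ _).
  by move=> x; exact: cvg_cst.
by case: pselect => /= ? //; rewrite -By.
Qed.

Lemma cutoff_scale_continuous a :
  continuous (fun y : 'rV[R]_n => Num.max 0 (Num.min 1 (a - 4 * sqnorm y)) *: y).
Proof.
move=> y; have c : Num.max 0 (Num.min 1 (a - 4 * sqnorm u)) @[u --> y] -->
    Num.max 0 (Num.min 1 (a - 4 * sqnorm y)).
  exact: cvg_comp (@sqnorm_continuous R n y) (@cutoff_continuous R a (sqnorm y)).
exact: cvgZ c cvg_id.
Qed.

Lemma position_continuous i : {within skel K n, continuous (position i)}.
Proof.
apply: (cellwise_continuous to_free) => [|j h|j h y By].
- by move=> x; exact: cvg_cst.
- case: pselect => ? /=; first exact: continuous_subspaceT (@cutoff_scale_continuous 4).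
  by move=> x; exact: cvg_cst.
case: pselect => /= ? //; rewrite (_ : sqnorm y = 1) // /outer_cutoff.
by rewrite (_ : 4 - 4 * 1 = 0) ?min_r ?maxxx ?scale0r //; ring.
Qed.

Lemma radial_continuous : {within skel K n, continuous radial}.
Proof.
apply: (cellwise_continuous to_free) => [|i g|i g y By].
- exact: continuous_subspaceT (fun x => cvg_id).
- apply/subspace_continuousP => y Dy.
  pose q u : 'rV[R]_n := (Num.max (1 / 2) (Num.sqrt (sqnorm u)))^-1 *: u.
  apply: (@within_comp _ _ _ _ (disk R n) q (fun v => to (chi i v) g)) => //.
  + move=> u Du; rewrite /disk /= -/(sqnorm _) sqnormZ exprVn.
    set m := Num.max _ _.
    have m0 : 0 < m by rewrite lt_max; apply/orP; left; lra.
    rewrite ler_pdivrMl ?exprn_gt0 // mulr1 -[leLHS]sqr_sqrtr ?sqnorm_ge0 //.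
    have m0' := ltW m0; rewrite lerXn2r ?nnegrE ?sqrtr_ge0 //.
    by rewrite /m le_max lexx orbT.
  + exact: (@cvg_withinW _ _ q _ _ (@clipped_scale_continuous R n y)).
  + exact: act_chi_continuous.
rewrite (_ : sqnorm y = 1) // sqrtr1 max_r ?invr1 ?scale1r //; lra.
Qed.

Variables (L : cell K n -> 'M[R]_(N.+1, #|[set: gT]%G|) -> 'rV[R]_n).
Variables (z : cell K n -> 'rV[R]_n).
Hypothesis L_cont : forall i, {within join, continuous (L i)}.
Hypothesis L_act : forall i M g, join M -> L i (regular_act M g) = L i M.
Hypothesis L_approx : forall i M j, join M ->
  `|L i M 0 j - position i (f M) 0 j| <= (8 * n%:R)^-1.
Hypothesis z_small : forall i j, `|z i 0 j| <= (8 * n%:R)^-1.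
Hypothesis L_neq : forall i M, join M -> L i M != z i.

(** For [y] the coordinate of [f M], this is [L i M - z i] near the centre, nonzero because [z i] is
    missed, and [y] itself once the squared norm reaches 1/2. *)
Definition displaced i M y : 'rV[R]_n :=
  y + inner_cutoff (sqnorm y) *: (L i M - position i (f M) - z i).

Definition pushed M : X :=
  if coord K n (f M) is Some (i, g, y) then to (chi i (unit_vector (displaced i M y))) g
  else f M.

Lemma position_coord i g y x : coord K n x = Some (i, g, y) ->
  position i x = outer_cutoff (sqnorm y) *: y.
Proof. by rewrite /position /cellwise => ->; case: pselect. Qed.

Lemma displaced_neq0 i g y M : join M -> coord K n (f M) = Some (i, g, y) ->
  displaced i M y != 0.
Proof.
move=> jM e; rewrite /displaced (position_coord e).
apply: pushed_neq0 => //; last exact: L_neq.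
  by have [] := coord_cell e.
by move=> j; rewrite -(position_coord e); exact: L_approx.
Qed.

Lemma pushed_below M : join M -> below n (pushed M).
Proof.
move=> jM; rewrite /pushed; case e : coord => [[[i g] y]|].
  apply: below_act; apply: chi_boundary.
  exact: sqnorm_unit (displaced_neq0 jM e).
exact: (coord_None to_free (f_skel jM) e).
Qed.

Lemma pushed_act M g : join M -> pushed (regular_act M g) = to (pushed M) g.
Proof.
move=> jM; rewrite /pushed f_act // (coord_act K to_free).
case e : coord => [[[i h] y]|] //.
rewrite total_actM /displaced L_act // f_act // (position_coord e).
by rewrite (@position_coord i (h * g)%g y) // (coord_act K to_free) e.
Qed.

Lemma pushed_continuous : {within join, continuous pushed}.
Proof.
apply/subspace_continuousP => M0 jM0.
rewrite -[from_subspace _ _ _]/(pushed M0) -[from_subspace _ _]/pushed.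
have FF : Filter (within join (nbhs M0)) by exact: within_filter.
have fM0 := (subspace_continuousP _ _).1 f_cont M0 jM0.
have njoin : \forall M \near within join (nbhs M0), join M by exact: withinT.
have comp (Z : topologicalType) (h : X -> Z) : {within skel K n, continuous h} ->
    h (f M) @[M --> within join (nbhs M0)] --> h (f M0).
  by move=> hc; apply: (within_comp jM0 f_skel fM0 hc).
(* Beyond squared radius 1/2 there is no displacement, and [pushed] agrees with [radial] after [f],
   on the lower skeleton as well. *)
have [r_big|r_small] := ltP (1 / 2) (radius (f M0)).
  have big : \forall M \near within join (nbhs M0), 1 / 2 < radius (f M).
    exact: (@cvgr_gt R _ _ FF _ _ (comp _ _ radius_continuous)).
  have E M : join M -> 1 / 2 < radius (f M) -> pushed M = radial (f M).
    move=> jM; rewrite /pushed /radial /radius /cellwise.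
    case e : coord => [[[i g] y]|] // y2.
    have -> : displaced i M y = y.
      rewrite /displaced (_ : inner_cutoff _ = 0) ?scale0r ?addr0 // /inner_cutoff.
      by rewrite max_l // ge_min; apply/orP; right; lra.
    rewrite /unit_vector max_r //.
    rewrite -[leLHS]ger0_norm; last lra.
    rewrite -sqrtr_sqr ler_sqrt ?sqnorm_ge0 //; lra.
  rewrite E //.
  apply: cvg_trans (comp _ _ radial_continuous); apply: near_eq_cvg.
  by apply: filterS2 njoin big => M jM rM; rewrite /= E.
case e0 : (coord K n (f M0)) => [[[i g] y0]|]; last first.
  by move: r_small; rewrite /radius /cellwise e0; lra.
have rad0 : cell_radius i g (f M0) < 3 / 4.
  move: r_small; rewrite /radius /cell_radius /cellwise e0.
  by case: pselect => /= [?|[]] //; lra.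
have small : \forall M \near within join (nbhs M0), cell_radius i g (f M) < 3 / 4.
  exact: (@cvgr_lt R _ _ FF _ _ (comp _ _ (@cell_radius_continuous i g))).
(* Further in, nearby images stay in the same open cell where the outer cutoff is 1, so the
   displaced vector is this expression in continuous functions of [M]. *)
pose w M := position i (f M) +
  inner_cutoff (cell_radius i g (f M)) *: (L i M - position i (f M) - z i).
have E M : join M -> cell_radius i g (f M) < 3 / 4 ->
    exists2 y, coord K n (f M) = Some (i, g, y) & displaced i M y = w M.
  move=> jM; rewrite /w /cell_radius /cellwise; case e : coord => [[[j h] y]|]; last lra.
  case: pselect => /= [[ji hg]|?]; last lra.
  subst j h => y34; exists y => //; rewrite /displaced.
  suff -> : position i (f M) = y by [].
  rewrite (position_coord e) /outer_cutoff min_l ?max_r ?scale1r //; lra.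
have w_cvg : w M @[M --> within join (nbhs M0)] --> w M0.
  have pc := comp _ _ (@position_continuous i).
  have Lc := (subspace_continuousP _ _).1 (@L_cont i) M0 jM0.
  have rc := comp _ _ (@cell_radius_continuous i g).
  have tc : inner_cutoff (cell_radius i g (f M)) @[M --> within join (nbhs M0)] -->
      inner_cutoff (cell_radius i g (f M0)).
    apply: (@cvg_comp _ _ _ (fun M => cell_radius i g (f M)) (@inner_cutoff R) _ _ _ rc).
    exact: cutoff_continuous.
  have d1 : L i M - position i (f M) @[M --> within join (nbhs M0)] -->
      L i M0 - position i (f M0) by exact: (cvgB Lc pc).
  have d2 : L i M - position i (f M) - z i @[M --> within join (nbhs M0)] -->
      L i M0 - position i (f M0) - z i by exact: (cvgB d1 (cvg_cst (z i))).
  exact: (cvgD pc (cvgZ tc d2)).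
have w0 : w M0 != 0.
  have [y e <-] := E _ jM0 rad0; exact: displaced_neq0 e.
have uw_cvg : unit_vector (w M) @[M --> within join (nbhs M0)] --> unit_vector (w M0).
  apply: (@cvg_comp _ _ _ w (@unit_vector R n) _ _ _ w_cvg).
  exact: unit_vector_continuous.
have pE M : join M -> cell_radius i g (f M) < 3 / 4 ->
    pushed M = to (chi i (unit_vector (w M))) g.
  by move=> jM rM; have [y e <-] := E _ jM rM; rewrite /pushed e.
rewrite pE //.
apply: (@cvg_trans _ ((fun M => to (chi i (unit_vector (w M))) g) @ within join (nbhs M0))).
  by apply: near_eq_cvg; apply: filterS2 njoin small => M jM rM; rewrite /= pE.
apply: (@within_comp _ _ _ join (disk R n) (fun M => unit_vector (w M))
  (fun v => to (chi i v) g)) => //.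
- by move=> M _; exact: disk_unit.
exact: act_chi_continuous.
Qed.

End Push.

(** * An equivariant map from the join to the N-skeleton *)

Section MapToSkeleton.
Variables (R : realType) (gT : finGroupType) (X : topologicalType).
Variables (to : {action gT &-> X}) (K : GCW R to) (N : nat).
Hypothesis to_free : free_action to.
Local Notation space := 'M[R]_(N.+1, #|[set: gT]%G|).
Local Notation join := (@join R gT N).

Definition equivariant_to_skel n (f : space -> X) :=
  [/\ {within join, continuous f}, forall M, join M -> skel K n (f M) &
      forall M g, join M -> f (regular_act M g) = to (f M) g].

(** The cells have dimension n + 1 > N, so each invariant function [position i] after [f] has an
    invariant approximation missing a point, one choice per orbit of cells. *)
Lemma push_skel n f : (N <= n)%N -> equivariant_to_skel n.+1 f ->
  exists f', equivariant_to_skel n f'.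
Proof.
move=> Nn [fc fs fa].
have c0 : 0 < (8 * n.+1%:R)^-1 :> R by rewrite invr_gt0 mulr_gt0 ?ltr0n.
have posc (i : cell K n.+1) : {within join, continuous (fun M => position i (f M))}.
  apply/subspace_continuousP => M jM.
  exact: (within_comp jM fs ((subspace_continuousP _ _).1 fc M jM)
    (@position_continuous R gT X to K to_free n.+1 i)).
have posa (i : cell K n.+1) M g : join M -> position i (f (regular_act M g)) = position i (f M).
  move=> jM; rewrite fa // /position /cellwise (coord_act K to_free).
  by case: coord => [[[j h] y]|].
have /choice [L /choice [z Lz]] := fun i : cell K n.+1 =>
  @approx_missing R gT N n.+1 (fun M => position i (f M)) _ Nn c0 (posc i) (posa i).
have Lc i : {within join, continuous (L i)} by case: (Lz i).
have La i M g : join M -> L i (regular_act M g) = L i M by case: (Lz i) => _ + _ _ _; apply.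
have Le i M j : join M -> `|L i M 0 j - position i (f M) 0 j| <= (8 * n.+1%:R)^-1.
  by case: (Lz i) => _ _ + _ _; apply.
have zc i j : `|z i 0 j| <= (8 * n.+1%:R)^-1 by case: (Lz i) => _ _ _ + _; apply.
have Ln i M : join M -> L i M != z i by case: (Lz i) => _ _ _ _; apply.
exists (pushed f L z); split.
- exact: (pushed_continuous to_free fc fs Lc Le zc Ln).
- exact: (pushed_below to_free fs Le zc Ln).
- by move=> M g jM; exact: (pushed_act to_free fa z La g jM).
Qed.

Lemma exists_map_skel : contractible R X -> exists f, equivariant_to_skel N f.
Proof.
case=> x0 [H [Hc H0 H1]].
pose f : space -> X := classify to x0 H N.+1.
have b1 M : join M -> 0 < weight_below M N.+1 by move=> jM; rewrite weight_below_top.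
have fc : {within join, continuous f}.
  apply/subspace_continuousP => M jM.
  exact: (classify_cvg (act_continuous K) Hc H0 H1 jM (b1 M jM)).
have fa M g : join M -> f (regular_act M g) = to (f M) g.
  by move=> jM; apply: (classify_act to H0 H1) => //; exact: b1.
(* The finite skeleton is enlarged to N + n, so that n pushes end at N. *)
have [n fn] := compact_image_skel K to_free (@join_compact R gT N) fc.
have : equivariant_to_skel (N + n) f.
  by split=> // M jM; apply: (skel_le (leq_addl N n)); exact: fn.
elim: n f {fc fa fn} => [|n IH] f fe; first by exists f; rewrite addn0 in fe.
have [f' fe'] := push_skel (leq_addr n N) (eq_rect _ (equivariant_to_skel^~ f) fe _ (addnS N n)).
exact: IH fe'.
Qed.

End MapToSkeleton.

(** * Labelling the sphere *)

Section Gaps.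
Variables (R : realType) (I : finType).
Implicit Types (v : I -> R) (A : {set I}) (e : R).

Definition has_gap e v A := [forall g in A, forall h in ~: A, v h + e <= v g].

Lemma has_gapP e v A : reflect
  (forall g h, g \in A -> h \notin A -> v h + e <= v g) (has_gap e v A).
Proof.
apply: (iffP forall_inP) => [H g h gA hA|H g gA].
  by have /forall_inP := H g gA; apply; rewrite inE.
by apply/forall_inP => h; rewrite inE; exact: H.
Qed.

(** Distinct sets of equal size would give g in A only and h in A' only; then v g exceeds v h by e
    while v' h exceeds v' g by e, too much for v and v' so close. *)
Lemma has_gap_uniq e v v' A A' : (forall g, `|v g - v' g| < e / 2) ->
  has_gap e v A -> has_gap e v' A' -> #|A| = #|A'| -> A = A'.
Proof.
move=> close /has_gapP gA /has_gapP gA' cA; apply/eqP; rewrite eqEcard cA leqnn andbT.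
apply/fintype.subsetP => g gIA; apply: contraT => gNA'.
have [h hA' hNA] : exists2 h, h \in A' & h \notin A.
  apply/fintype.subsetPn; apply/negP => A'A; move: gNA'.
  by have /eqP -> : A' == A; rewrite ?gIA // eqEcard A'A cA leqnn.
have e0 : 0 < e by have := le_lt_trans (normr_ge0 _) (close g); lra.
have := gA g h gIA hNA; have := gA' h g hA' gNA'.
have := close g; have := close h; rewrite !ltr_norml => /andP [? ?] /andP [? ?] ? ?; exfalso; clear cA; lra.
Qed.

(** Lower a threshold from the maximum in steps of e. Without a gap each step adds an element to the
    superlevel set, so after #|I| steps it has more than #|I| elements. *)
Lemma exists_gap e v g0 h0 : 0 < e -> #|I|%:R * e < v g0 - v h0 ->
  exists A, [/\ A != finset.set0, A != finset.setT & has_gap e v A].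
Proof.
move=> e0 spread; apply: contrapT => none.
have [g _ gmax] := @arg_maxP _ _ I g0 xpredT v isT.
pose A (t : nat) := [set h | v g - t%:R * e <= v h]%SET.
have gA t : g \in A t by rewrite inE lerBlDr lerDl mulr_ge0 ?ler0n // ltW.
have notfull t : (t <= #|I|)%N -> A t != finset.setT.
  move=> tI; apply/eqP => full.
  have le : v g - t%:R * e <= v h0 by have := finset.in_setT h0; rewrite -full inE.
  have gm : v g0 <= v g := gmax g0 isT; have : t%:R * e <= #|I|%:R * e by rewrite ler_wpM2r ?ler_nat // ltW.
  by lra.
have card t : (t <= #|I|)%N -> (t < #|A t|)%N.
  elim: t => [|t IH] tI; first by apply/card_gt0P; exists g.
  apply: leq_ltn_trans (IH (ltnW tI)) _; apply: proper_card; rewrite properE.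
  have At : A t != finset.set0 by apply/set0Pn; exists g.
  have : ~~ has_gap e v (A t).
    by apply/negP => gap; apply: none; exists (A t); rewrite At notfull // ltnW.
  rewrite negb_forall_in => /exists_inP [a aA]; rewrite negb_forall_in.
  case/exists_inP => b; rewrite inE => bA; rewrite -ltNge => ba.
  apply/andP; split.
    apply/fintype.subsetP => h; rewrite !inE; apply: le_trans.
    by rewrite lerD2l lerN2 ler_wpM2r ?ler_nat // ltW.
  apply/fintype.subsetPn; exists b => //; move: aA; rewrite !inE -natr1 mulrDl mul1r.
  by lra.
have := card #|I| (leqnn _); rewrite ltnNge => /negP; apply.
exact: max_card.
Qed.

End Gaps.

(** * Equivariant labels from gaps in the rows *)

Section SphereLabels.
Variables (R : realType) (p : nat) (gT : finGroupType) (x0 : gT) (k : nat).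
Hypothesis p_pr : prime p.
Hypothesis gen : [set: gT]%G = <[x0]>%G.
Hypothesis order_x0 : #[x0]%g = p.
Local Notation nG := #|[set: gT]%G|.
Local Notation F := 'F_p.
Implicit Types (M : 'M[R]_(k.+1, nG)) (c : F) (A : {set gT}).

Definition pow c : gT := (x0 ^+ (c : nat))%g.

Lemma pow_D c d : pow (c + d) = (pow c * pow d)%g.
Proof.
rewrite /pow -expgD -[RHS](expg_mod_order x0) order_x0; congr (_ ^+ _)%g.
by rewrite -(val_Fp_nat p_pr) natrD !natr_Zp.
Qed.

Lemma pow_inj : injective pow.
Proof.
move=> c d /eqP; rewrite eq_expg_mod_order order_x0 => /eqP e; apply: val_inj => /=.
have lt (a : F) : (a < p)%N by rewrite -[X in (_ < X)%N](Fp_cast p_pr) ltn_ord.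
by move: e; rewrite !modn_small.
Qed.

Lemma pow_onto g : exists c, g = pow c.
Proof.
have /cyclePmin [i ip ->] : g \in <[x0]>%g by rewrite -[<[x0]>%g]/(gval <[x0]>%G) -gen inE.
exists (i%:R : F); rewrite /pow val_Fp_nat // -order_x0.
by rewrite expg_mod_order.
Qed.

Definition log g : F := odflt 0 [pick c | pow c == g].

Lemma pow_log g : pow (log g) = g.
Proof.
rewrite /log; case: pickP => [c /eqP //|none]; have [c e] := pow_onto g.
by have := none c; rewrite e eqxx.
Qed.

Lemma log_mul g c : log (g * pow c)%g = log g + c.
Proof. by apply: pow_inj; rewrite pow_D !pow_log. Qed.

Lemma card_group : #|gT| = p.
Proof. by rewrite -cardsT -[finset.setT]/(gval [set: gT]%G) gen -order_x0. Qed.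

Definition mean_log A : F := (\sum_(g in A) log g) / #|A|%:R.

Lemma neq_setT_card A : (A != finset.setT) = ~~ (#|[set: gT]%SET| <= #|A|)%N.
Proof. by rewrite eqEcard finset.subsetT. Qed.

(** Translation adds #|A| c to the sum of logarithms, and #|A| is invertible mod p for a proper
    nonempty subset. *)
Lemma mean_log_mul A c : A != finset.set0 -> A != finset.setT ->
  mean_log (A :* pow c)%g = mean_log A + c.
Proof.
move=> A0 AT; rewrite /mean_log card_rcoset.
have nz : #|A|%:R != 0 :> F.
  rewrite -(dvdn_pcharf (pchar_Fp p_pr)) gtnNdvd ?card_gt0 // -card_group -cardsT.
  by rewrite ltnNge -neq_setT_card.
rewrite -[in LHS]rcosetE big_imset /=; last by move=> g h _ _; apply: mulIg.
under eq_bigr => g _ do rewrite log_mul.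
rewrite big_split /= sumr_const -[_ *+ _]mulr_natr mulrDl mulfK //.
Qed.

Variable e : R.
Hypothesis e0 : 0 < e.

(** The number [l] encodes the row, its quotient by p - 1, and the size of [A] minus 1, its
    remainder; the (k+1)(p-1) codes are as many as the dimension of the representation. *)
Definition gap_at M (l : nat) A :=
  [&& A != finset.set0, A != finset.setT, #|A| == (l %% p.-1).+1 &
      has_gap e (fun g => M (inord (l %/ p.-1)) (idx g)) A].

(** The least code with a gap; without any, [find] returns the length of the list, the case excluded
    by [labellable]. *)
Definition level M := find (fun l => [exists A, gap_at M l A]) (iota 0 (k.+1 * p.-1)).
Definition chosen M : {set gT} := odflt finset.set0 [pick A | gap_at M (level M) A].
Definition sphere_label M : nat * F := (level M, mean_log (chosen M)).

Lemma gap_at_uniq M M' l A A' : `|M - M'| < e / 2 -> gap_at M l A -> gap_at M' l A' -> A = A'.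
Proof.
move=> close /and4P [_ _ /eqP cA gA] /and4P [_ _ /eqP cA' gA'].
apply: has_gap_uniq gA gA' _; last by rewrite cA cA'.
move=> g; apply: le_lt_trans close.
by have := le_mx_norm (M - M') (inord (l %/ p.-1)) (idx g); rewrite !mxE.
Qed.

Lemma gap_at_act M l A c : gap_at M l A -> gap_at (regular_act M (pow c)) l (A :* pow c)%g.
Proof.
case/and4P => A0 AT cA /has_gapP gA; apply/and4P; split.
- by rewrite -card_gt0 card_rcoset card_gt0.
- by move: AT; rewrite !neq_setT_card card_rcoset.
- by rewrite card_rcoset.
apply/has_gapP => g h; rewrite !mem_rcoset => gA' hA'.
by rewrite !regular_actE; exact: gA.
Qed.

Lemma level_act M c : level (regular_act M (pow c)) = level M.
Proof.
apply: eq_find => l; apply/existsP/existsP => -[A gA]; last first.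
  by exists (A :* pow c)%g; exact: gap_at_act.
have := gap_at_act (- c) gA; set M' := regular_act _ _.
have -> : M' = M.
  rewrite /M' regular_actM -pow_D subrr.
  by rewrite /pow expg0 regular_act1.
by move=> gM; eexists; exact: gM.
Qed.

Definition labellable M := (level M < k.+1 * p.-1)%N.

Lemma gap_at_chosen M : labellable M -> gap_at M (level M) (chosen M).
Proof.
rewrite /labellable => lM; rewrite /chosen.
have : has (fun l => [exists A, gap_at M l A]) (iota 0 (k.+1 * p.-1)).
  by rewrite has_find size_iota.
move/(nth_find 0%N); rewrite -/(level M) nth_iota // add0n => /existsP [A gA].
by case: pickP => [//|/(_ A)]; rewrite gA.
Qed.

Lemma sphere_label_act M c : labellable M ->
  sphere_label (regular_act M (pow c)) = shift c (sphere_label M).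
Proof.
move=> lM; rewrite /sphere_label level_act /shift /=; congr (_, _).
have gM := gap_at_chosen lM; have lM' : labellable (regular_act M (pow c)).
  by rewrite /labellable level_act.
have gM' := gap_at_chosen lM'; rewrite level_act in gM'.
rewrite -(gap_at_uniq _ (gap_at_act c gM) gM') ?subrr ?normr0 ?divr_gt0 //.
by have /and4P [A0 AT _ _] := gM; exact: mean_log_mul.
Qed.

Lemma sphere_label_close M M' : labellable M -> labellable M' -> `|M - M'| < e / 2 ->
  level M = level M' -> sphere_label M = sphere_label M'.
Proof.
move=> lM lM' close ll; have gM := gap_at_chosen lM; have gM' := gap_at_chosen lM'.
rewrite ll in gM; have E := gap_at_uniq close gM gM'.
by rewrite /sphere_label ll E.
Qed.

Lemma sphere_labellable M : p%:R * (k.+1 * p)%:R * e <= 1 / 2 ->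
  reduced_regular_sphere R gT k.+1 M -> labellable M.
Proof.
move=> e_small [rows unit].
set m : R := p%:R * e.
have p0 : 0 < p%:R :> R by rewrite ltr0n prime_gt0.
have m0 : 0 < m by rewrite mulr_gt0.
(* Otherwise the (k+1)p squares of entries, each at most m^2, would sum to at most 1/4. *)
have [i [g big]] : exists i g, m < `|M i (idx g)|.
  apply: contrapT => none.
  have sq i j : M i j ^+ 2 <= m ^+ 2.
    have [g ->] := idx_onto j; rewrite -[leLHS]real_normK ?num_real //.
    rewrite lerXn2r ?nnegrE // ?(ltW m0) // leNgt; apply/negP => lt.
    by apply: none; exists i, g.
  have : 1 <= \sum_(i < k.+1) \sum_(j < nG) m ^+ 2.
    by rewrite -unit; apply: ler_sum => i _; apply: ler_sum => j _; exact: sq.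
  rewrite !sumr_const !card_ord cardsT card_group -mulrnA mulnC.
  rewrite -[_ *+ (_ * _)]mulr_natl expr2 mulrA.
  have -> : (k.+1 * p)%:R * m = p%:R * (k.+1 * p)%:R * e by rewrite /m; ring.
  have m1 : m <= 1 / 2.
    apply: le_trans e_small; rewrite /m -mulrA ler_wpM2l ?(ltW p0) //.
    have q1 : 1 <= (k.+1 * p)%:R :> R by rewrite (ler_nat R 1) muln_gt0 /= (prime_gt0 p_pr).
    exact: ler_peMl (ltW e0) q1.
  have : p%:R * (k.+1 * p)%:R * e * m <= 1 / 2 * (1 / 2).
    by apply: ler_pM => //; rewrite ?mulr_ge0 ?ler0n ?ltW.
  lra.
have row0 : \sum_h M i (idx h) = 0.
  by rewrite -sum_idx -[RHS](rows i); apply: eq_bigr => j _; rewrite mxE.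
(* If all differences in the row were at most m, every entry would have the sign of the large one,
   and the row sum could not be zero. *)
have [a [b spread]] : exists a b, #|gT|%:R * e < M i (idx a) - M i (idx b).
  rewrite card_group -/m; apply: contrapT => none.
  have near_g a b : M i (idx a) - M i (idx b) <= m.
    by rewrite leNgt; apply/negP => lt; apply: none; exists a, b.
  move: row0; rewrite (bigD1 g) //=; set S := \sum_(_ | _) _ => row0.
  move: big; rewrite lter_normr => /orP [pos|neg].
    have : 0 <= S by apply: sumr_ge0 => b _; have := near_g g b; lra.
    by lra.
  have : S <= 0 by apply: sumr_le0 => a _; have := near_g a g; lra.
  by lra.
have [A [A0 AT gapA]] :=
  @exists_gap R gT e (fun h => M i (idx h)) a b e0 spread.
have A_lt : (#|A|.-1 < p.-1)%N.
  have : (#|A| < p)%N by move: AT; rewrite neq_setT_card cardsT card_group -ltnNge.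
  by have := A0; rewrite -card_gt0; lia.
pose l := (i * p.-1 + #|A|.-1)%N.
have lN : (l < k.+1 * p.-1)%N.
  by apply: leq_trans (_ : i.+1 * p.-1 <= _)%N; [rewrite /l mulSn; lia | rewrite leq_mul2r ltn_ord orbT].
have p1 : (0 < p.-1)%N by case: p.-1 A_lt.
have gl : gap_at M l A.
  rewrite /gap_at A0 AT /l modnMDl modn_small // prednK ?card_gt0 // eqxx /=.
  by rewrite divnMDl // divn_small // addn0 inord_val.
rewrite /labellable /level -[X in (_ < X)%N](size_iota 0) -has_find.
apply/hasP; exists l; first by rewrite mem_iota add0n.
by apply/existsP; exists A.
Qed.

End SphereLabels.

(** * Shrinking of diameters under barycentric subdivision *)

Section Barycenter.
Variables (R : realType) (V : normedModType R).
Implicit Types (s : seq V) (e : R).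

Definition bary s : V := (size s)%:R^-1 *: \sum_(x <- s) x.

Lemma bary_sub s v : 0 < (size s)%:R :> R ->
  bary s - v = (size s)%:R^-1 *: \sum_(x <- s) (x - v).
Proof.
move=> n0; rewrite big_split /= scalerDr; congr (_ + _).
rewrite big_const_seq count_predT iter_addr_0 -[- v *+ _]scaler_nat scalerA.
by rewrite mulVf ?scale1r // gt_eqF.
Qed.

(** The summand of [v] itself is zero; the missing term produces the contraction factor. *)
Lemma bary_dist s v e : v \in s -> (forall x, x \in s -> `|x - v| <= e) ->
  `|bary s - v| <= (1 - (size s)%:R^-1) * e.
Proof.
move=> vs close; have n0 : 0 < (size s)%:R :> R.
  by rewrite ltr0n; case: s vs {close}.
rewrite bary_sub // normrZ gtr0_norm ?invr_gt0 // ler_pdivrMl //.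
rewrite mulrA mulrBr mulr1 mulfV ?gt_eqF //.
rewrite (perm_big _ (perm_to_rem vs)) big_cons /= subrr add0r.
apply: le_trans (ler_norm_sum _ _ _) _.
apply: le_trans (_ : \sum_(x <- rem v s) e <= _).
  rewrite big_seq [leRHS]big_seq; apply: ler_sum => x /mem_rem; exact: close.
rewrite big_const_seq count_predT iter_addr_0 size_rem // -[e *+ _]mulr_natl.
by rewrite -subn1 natrB // -(ltr_nat R).
Qed.

Lemma bary_ball s v e : s != [::] -> (forall x, x \in s -> `|x - v| <= e) ->
  `|bary s - v| <= e.
Proof.
move=> s0 close; have n0 : 0 < (size s)%:R :> R by rewrite ltr0n; case: s s0 {close}.
rewrite bary_sub // normrZ gtr0_norm ?invr_gt0 // ler_pdivrMl //.
apply: le_trans (ler_norm_sum _ _ _) _.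
apply: le_trans (_ : \sum_(x <- s) e <= _).
  rewrite big_seq [leRHS]big_seq; apply: ler_sum => x; exact: close.
by rewrite big_const_seq count_predT iter_addr_0 mulr_natl.
Qed.

Definition diam_le e s := forall x y, x \in s -> y \in s -> `|x - y| <= e.

(** The factor uses a common bound [K] on the sizes, so that it does not change in the induction
    over faces. *)
Lemma flag_diam n K s s' e : (n <= K)%N -> size s = n -> diam_le e s -> flag bary n s s' ->
  diam_le ((1 - K%:R^-1) * e) s'.
Proof.
elim: n s s' => [|n IH] s s' nK sz se; first by move=> -> x y; rewrite (size0nil sz).
case=> r [t [rs szr -> fl]].
have sr : size r = n by move: szr; rewrite sz => -[].
have st : diam_le ((1 - K%:R^-1) * e) t.
  apply: IH fl => //; first exact: ltnW.
  by move=> x y /(mem_subseq rs) xs /(mem_subseq rs) ys; exact: se.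
have e0 : 0 <= e.
  case: s sz se {rs szr fl} => // v s _ se.
  by have := se v v (mem_head _ _) (mem_head _ _); rewrite subrr normr0.
have bs v : v \in s -> `|v - bary s| <= (1 - K%:R^-1) * e.
  move=> vs; rewrite distrC; apply: le_trans (bary_dist vs _) _.
    by move=> x xs; exact: se.
  rewrite ler_wpM2r // lerD2l lerN2 sz lef_pV2 ?posrE ?ltr0n ?ler_nat //.
  exact: leq_trans nK.
have bt y : y \in t -> `|y - bary s| <= (1 - K%:R^-1) * e.
  apply: (@flag_closed _ bary (fun y => `|y - bary s| <= (1 - K%:R^-1) * e) n r) => //.
    by move=> q q0 H; exact: bary_ball.
  by move=> x /(mem_subseq rs); exact: bs.
have K0 : 0 <= (1 - K%:R^-1) * e.
  rewrite mulr_ge0 // subr_ge0 invf_le1 ?ltr0n ?ler1n; exact: leq_trans nK.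
move=> x y; rewrite !in_cons => /predU1P [->|xt] /predU1P [->|yt].
- by rewrite subrr normr0.
- by rewrite distrC; exact: bt.
- exact: bt.
exact: st.
Qed.

Lemma iflag_diam m n s s' e : size s = n -> diam_le e s -> iflag bary m n s s' ->
  diam_le ((1 - n%:R^-1) ^+ m * e) s'.
Proof.
elim: m s e => [|m IH] s e sz se /=; first by move=> ->; rewrite mul1r.
case=> r [fr fl]; rewrite exprSr -mulrA.
apply: IH fl; first exact: flag_size fr.
exact: (flag_diam (leqnn n) sz se fr).
Qed.

End Barycenter.

(** * Excluding equivariant maps from the join to the sphere *)

Section NoMap.
Variables (R : realType) (gT : finGroupType) (x0 : gT) (p d : nat).
Hypothesis p_pr : prime p.
Hypothesis gen : [set: gT]%G = <[x0]>%G.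
Hypothesis order_x0 : #[x0]%g = p.
Local Notation nG := #|[set: gT]%G|.
Local Notation F := 'F_p.
Variable N : nat.
Local Notation space := 'M[R]_(N.+1, nG).
Local Notation join := (@join R gT N).
Local Notation bary := (@bary R space).
Implicit Types (x : space) (c : F).

Definition rotate c x : space := regular_act x (pow x0 c).

Lemma rotate0 x : rotate 0 x = x.
Proof. by rewrite /rotate /pow expg0 regular_act1. Qed.

Lemma rotate_D c c' x : rotate c (rotate c' x) = rotate (c + c') x.
Proof. by rewrite /rotate regular_actM -pow_D // addrC. Qed.

Lemma bary_rotate c (s : seq space) : bary (map (rotate c) s) = rotate c (bary s).
Proof.
rewrite /bary /rotate /regular_act size_map big_map -scalemxAl; congr (_ *: _).
by rewrite mulmx_suml.
Qed.

(* The letters [u] name the top simplex of the join, [k] one of its faces. *)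
Definition in_face (u : nat -> gT) k x :=
  [/\ forall i j, 0 <= x i j, \sum_i \sum_j x i j = 1 &
      forall i j, x i j != 0 -> (i < k)%N /\ j = idx (u i)].

Definition simplex k (s : seq space) := exists u, forall x, x \in s -> in_face u k x.

Lemma in_face_join u k x : in_face u k x -> join x.
Proof. by case=> x0' x1 xu; split=> // i j j' /xu [_ ->] /xu [_ ->]. Qed.

(** Rotation multiplies the letters of rows below [k] by one power of the generator, and row [k] is
    free to take the letter 1 of the new vertex. *)
Lemma simplex_cone k s c : (k <= N)%N -> simplex k s ->
  simplex k.+1 (vertex R gT N k :: map (rotate c) s).
Proof.
move=> kN [u us]; exists (fun i => if i == k then 1%g else (u i * pow x0 c)%g) => x.
rewrite in_cons => /predU1P [->|/mapP [y ys ->]].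
  split=> [i j||i j]; rewrite ?mxE ?ler0n //.
    rewrite (bigD1 (inord k)) //= (bigD1 (idx 1%g)) //= mxE !eqxx !big1 ?addr0 //.
      by move=> i /negPf ni; rewrite big1 // => j _; rewrite mxE ni.
    by move=> j /negPf nj; rewrite mxE nj andbF.
  rewrite pnatr_eq0 eqb0 negbK => /andP [/eqP -> /eqP ->].
  by rewrite inordK ?ltnS // eqxx.
have fy := us y ys; have [y0 y1 yu] := fy.
have [z0 z1 _] := join_act (pow x0 c) (in_face_join fy).
split=> // i j; have [h ->] := idx_onto j; rewrite regular_actE => /yu [ik /idx_inj e].
by rewrite ltnW // ltn_eqF // -e mulgKV.
Qed.

Lemma simplex_nil : simplex 0 [::].
Proof. by exists (fun=> 1%g). Qed.

Lemma in_face_bary u k (s : seq space) : s != [::] ->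
  (forall x, x \in s -> in_face u k x) -> in_face u k (bary s).
Proof.
move=> s0 H; have n0 : 0 < (size s)%:R :> R by rewrite ltr0n; case: s s0 {H}.
have entry i j : bary s i j = (size s)%:R^-1 * \sum_(x <- s) x i j.
  by rewrite mxE summxE.
split=> [i j||i j].
- rewrite entry mulr_ge0 ?invr_ge0 ?ler0n // big_seq; apply: sumr_ge0 => x /H.
  by case.
- under eq_bigr => i _ do under eq_bigr => j _ do rewrite entry.
  under eq_bigr => i _ do rewrite -mulr_sumr exchange_big /=.
  rewrite -mulr_sumr exchange_big /= big_seq (eq_bigr (fun=> 1)) => [|x /H []//].
  by rewrite -big_seq big_const_seq count_predT iter_addr_0 mulVf // gt_eqF.
rewrite entry; apply: contraNP => nf; apply/eqP.
rewrite big_seq big1 ?mulr0 // => x /H [_ _ xu]; apply/eqP; apply: contraT => /xu.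
by move/nf.
Qed.

Lemma simplex_flag k s s' : simplex k s -> size s = k -> flag bary k s s' -> simplex k s'.
Proof.
move=> [u us] sz fl; exists u.
exact: (flag_closed (P := in_face u k) (@in_face_bary u k) sz us fl).
Qed.

Lemma simplex_diam k s : simplex k s -> diam_le 1 s.
Proof.
move=> [u us] x y xs ys; apply: mx_norm_le => // i j; rewrite !mxE.
have jx := in_face_join (us x xs); have jy := in_face_join (us y ys).
have := entry_le1 i j jx; have := entry_le1 i j jy.
have [xp _ _] := jx; have [yp _ _] := jy; have := xp i j; have := yp i j.
by rewrite ler_norml => *; apply/andP; split; lra.
Qed.

Lemma no_equivariant_map (f : space -> 'M[R]_(d.+1, nG)) : N = (d.+1 * p.-1)%N ->
  {within join, continuous f} ->
  (forall x, join x -> reduced_regular_sphere R gT d.+1 (f x)) ->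
  (forall x g, join x -> f (regular_act x g) = regular_act (f x) g) -> False.
Proof.
move=> NE fc fs fa.
(* The gap width for which the bound of [sphere_labellable] is attained. *)
pose e : R := (2 * (p%:R * (d.+1 * p)%:R))^-1.
have q0 : 0 < p%:R * (d.+1 * p)%:R :> R.
  by rewrite -natrM ltr0n !muln_gt0 /= (prime_gt0 p_pr).
have e0 : 0 < e by rewrite invr_gt0 mulr_gt0.
have e_small : p%:R * (d.+1 * p)%:R * e <= 1 / 2.
  by rewrite /e invfM mulrCA mulfV ?gt_eqF // mulr1 div1r.
have lab_ok x : join x -> labellable p e (f x).
  by move=> jx; apply: (sphere_labellable p_pr gen order_x0 e0 e_small (fs x jx)).
have e2 : 0 < e / 2 by rewrite divr_gt0.
have [r r0 rP] := compact_unif_continuous (@join_compact R gT N) fc e2.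
(* Simplices of the join have diameter at most 1, so after [m] subdivisions they are smaller than
   [r] and [f] varies by less than e / 2 on each. *)
have [m mr] : exists m, (1 - N.+1%:R^-1) ^+ m < r :> R.
  have q1 : `|1 - N.+1%:R^-1| < 1 :> R.
    have i0 : 0 < N.+1%:R^-1 :> R by rewrite invr_gt0 ltr0n.
    have i1 : N.+1%:R^-1 <= 1 :> R by rewrite invf_le1 ?ltr0n // ler1n.
    by move: i0 i1; set a := _^-1 => i0 i1; rewrite ger0_norm; lra.
  have near_r : \forall t \near \oo, (1 - N.+1%:R^-1) ^+ t < r.
    exact: (cvgr_lt 0 (cvg_expr q1) r r0).
  by have [m] := filter_ex near_r; exists m.
apply: (@no_fine_labelling p p_pr space rotate rotate0 rotate_D (vertex R gT N) N simplex
  _ simplex_nil bary bary_rotate simplex_flag (fun x => sphere_label p x0 e (f x)) _ m).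
- by move=> k s c kN ks _; exact: simplex_cone.
- move=> k s c x [u us] _ xs; have jx := in_face_join (us x xs).
  rewrite fa //; apply: sphere_label_act => //; exact: lab_ok.
move=> s s' ss sz fl.
have [[u us] _] := iflag_simp simplex_flag ss sz fl.
have jn x : x \in s' -> join x by move/us; exact: in_face_join.
split=> [x y xs ys ll|x xs]; last by rewrite NE; exact: lab_ok (jn x xs).
apply: sphere_label_close ll => //; try exact: lab_ok (jn _ _).
apply: rP; [exact: jn | exact: jn | apply: le_lt_trans mr].
by have := iflag_diam sz (simplex_diam ss) fl xs ys; rewrite mulr1.
Qed.

End NoMap.

Theorem theorem4p5 (R : realType) (p d : nat) (Cp : finGroupType)
    (EC : topologicalType) (to : {action Cp &-> EC}) (K : GCW R to) :
  prime p -> (1 <= d)%N ->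
  cyclic [set: Cp]%G -> #|[set: Cp]%G| = p ->
  free_action to -> contractible R EC ->
  ~ exists f : EC -> 'M[R]_(d.+1, #|[set: Cp]%G|),
      equivariant_map to (@regular_act R Cp d.+1)
        (skel K ((p - 1) * (d + 1))) (reduced_regular_sphere R Cp d.+1) f.
Proof.
move=> p_pr _ /cyclicP [x0 gen] card_p to_free contr [f [fc fs fa]].
(* The dimension of the join, that of the skeleton and the number of levels are all (p-1)(d+1). *)
have [h [hc hs ha]] := exists_map_skel K ((p - 1) * (d + 1))%N to_free contr.
apply: (@no_equivariant_map R Cp x0 p d p_pr _ _ ((p - 1) * (d + 1))%N (f \o h)).
- exact: val_inj.
- by rewrite -card_p /= gen.
- by rewrite subn1 addn1 mulnC.
- apply/subspace_continuousP => x jx.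
  exact: (within_comp jx hs ((subspace_continuousP _ _).1 hc x jx) fc).
- by move=> x jx; apply: fs; exact: hs.
by move=> x g jx; rewrite /= ha // fa //; exact: hs.
Qed.
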